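(* Let $G$ be a finite group, $K$ a field, and let $\mathcal{C}=(\mathcal{C},\theta)$ be a twisted Frobenius algebra bundle on $BG$. Then the $0$-th Hochschild homology bundle $\mathcal{HH}_0(\mathcal{C})=\bigoplus_{g\in G}\mathcal{HH}_0(\mathcal{C})_g$, equipped with the $G$-action given by the operators $\mathcal{T}(g)$, the multiplication given by the maps $m_{g,h}$, the comultiplication given by the maps $\Delta_{g,h}$, and the functional $\theta_e:\mathcal{HH}_0(\mathcal{C})_e\to K$, $\theta_e(c)=\theta(c\,c_e)$, is a weak crossed $G$-algebra.
   Context: Throughout, $G$ is a finite group with unit element $e$ and $K$ is a field; all algebras, spaces and tensor products are over $K$. **Categorical action.** A categorical $G$-action on a unital associative algebra $\mathcal{C}$ consists of algebra automorphisms $\rho(g)$ of $\mathcal{C}$ ($g\in G$; write $g(c)=\rho(g)(c)$) and invertible elements $c_{g,h}\in\mathcal{C}$ ($g,h\in G$) and $c_e\in\mathcal{C}$ such that $\rho(g)\rho(h)=Ad(c_{g,h})\rho(gh)$ and $\rho(e)=Ad(c_e)$, where $Ad(c)(x)=cxc^{-1}$, and for all $g,h,k\in G$ $$c_{g,h}c_{gh,k}=g(c_{h,k})c_{g,hk},\quad c_{g,e}=g(c_e),\quad c_{e,g}=c_e.$$ (In particular $e(c)=\rho(e)(c)=c_e c c_e^{-1}$ need not equal $c$, and $gh(c)$ means $\rho(gh)(c)$.) **Twisted Frobenius algebra bundle on $BG$.** A finite-dimensional unital associative algebra $\mathcal{C}$ with a linear functional $\theta:\mathcal{C}\to K$ satisfying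 $\theta(ab)=\theta(ba)$, such that the pairing $(a,b)\mapsto\theta(ab)$ is non-degenerate, together with a categorical $G$-action satisfying $\theta(g(c))=\theta(c)$ for all $g\in G$, $c\in\mathcal{C}$. Let $\xi=\sum_i\xi_i'\otimes\xi_i''\in\mathcal{C}\otimes\mathcal{C}$ be the symmetric tensor inverse to the pairing: $c=\sum_i\xi_i'\,\theta(c\,\xi_i'')$ for all $c\in\mathcal{C}$. **Hochschild homology bundle.** For $h\in G$ let $\mathcal{C}_h=\mathrm{span}\{c_1c_2-c_2h(c_1)\mid c_1,c_2\in\mathcal{C}\}$, and set $\mathcal{HH}_0(\mathcal{C})_h=\mathcal{C}/\mathcal{C}_h$, $\mathcal{HH}_0(\mathcal{C})=\bigoplus_{h\in G}\mathcal{HH}_0(\mathcal{C})_h$. **Structure maps.** Each of the following linear maps descends to the indicated quotients. - $T_h(g):\mathcal{C}\to\mathcal{C}$, $T_h(g)(c)=c_e^{-1}c_{g,g^{-1}}^{-1}\,g(c)\,c_{g,h}\,c_{gh,g^{-1}}$, induces $\mathcal{T}_h(g):\mathcal{HH}_0(\mathcal{C})_h\to\mathcal{HH}_0(\mathcal{C})_{ghg^{-1}}$; $\mathcal{T}(g)$ is the operator on $\mathcal{HH}_0(\mathcal{C})$ whose restriction to $\mathcal{HH}_0(\mathcal{C})_h$ is $\mathcal{T}_h(g)$. - $m_{g,h}(c'\otimes c'')=\sum_i\xi_i'\,c'\,g(\xi_i''c'')\,c_{g,h}$ induces $m_{g,h}:\mathcal{HH}_0(\mathcal{C})_g\otimes\mathcal{HH}_0(\mathcal{C})_h\to\mathcal{HH}_0(\mathcal{C})_{gh}$.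 - $\Delta_{g,h}(c)=\sum_i c\,c_{g,h}^{-1}\,g(\xi_i')\otimes\xi_i''$ induces $\Delta_{g,h}:\mathcal{HH}_0(\mathcal{C})_{gh}\to\mathcal{HH}_0(\mathcal{C})_g\otimes\mathcal{HH}_0(\mathcal{C})_h$. - $c\mapsto\theta(c\,c_e)$ induces $\theta_e:\mathcal{HH}_0(\mathcal{C})_e\to K$. **Weak crossed $G$-algebra.** A finite-dimensional $G$-graded vector space $C=\bigoplus_{g\in G}C_g$ together with a group homomorphism $G\to GL(C)$ (written $c\mapsto g(c)$) with $g(C_h)=C_{ghg^{-1}}$ for all $g,h$ and $g|_{C_g}=\mathrm{id}$ for all $g$ (a ''special vector bundle on $\mathcal{L}BG$''), a $G$-invariant linear functional $\theta_e:C_e\to K$, an associative (not necessarily unital) algebra structure on $C$, and a coassociative coalgebra structure $\Delta:C\to C\otimes C$, such that: 1. $G$ acts by automorphisms of the algebra $C$; 2. $C_g\cdot C_h\subset C_{gh}$; 3. $c'c''=g(c'')c'$ for all $c'\in C_g$, $c''\in C_h$; 4. (torus axiom) for all $g,h\in G$ and $c\in C_{hgh^{-1}g^{-1}}$, $\mathrm{Tr}_{C_h}(L'_c\cdot g)=\mathrm{Tr}_{C_g}(h^{-1}\cdot L''_c)$, where $L'_c:C_{ghg^{-1}}\to C_h$ and $L''_c:C_g\to C_{hgh^{-1}}$ are the operators of left multiplication by $c$; 5. $G$ acts by automorphisms of the coalgebra $C$, i.e. $(g\otimes g)\Delta=\Delta g$; 6. $\Delta(C_k)\subset\bigoplus_{gh=k}C_g\otimes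 C_h$ (the component $C_{gh}\to C_g\otimes C_h$ is denoted $\Delta_{g,h}$); 7. $\Delta_{g,h}=\sigma(1\otimes h)\Delta_{h,h^{-1}gh}$ for all $g,h\in G$, where $\sigma$ is the transposition of tensor factors; 8. $(\theta_e\otimes1)\Delta_{e,g}=(1\otimes\theta_e)\Delta_{g,e}=\mathrm{id}_{C_g}$ for all $g\in G$; 9. $\Delta$ is a morphism of $C$-bimodules, where $C\otimes C$ has the left action on the first factor and the right action on the second factor. *)

(* Defs.v *)
From HB Require Import structures.
From mathcomp Require Import all_boot all_fingroup all_order all_algebra.

Set Implicit Arguments.
Unset Strict Implicit.
Unset Printing Implicit Defensive.

Import GRing.Theory VectorInternalTheory.
Local Open Scope ring_scope.

Lemma linfunE (K : fieldType) (U V : vectType K) (f : U -> V) :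
  linear f -> linfun f =1 f.
Proof.
move=> lin_f; pose m := GRing.isLinear.Build K U V _ f lin_f.
pose F : {linear U -> V} := HB.pack f m.
exact: (lfunE F).
Qed.

Definition lftrace (K : fieldType) (V : vectType K) (f : 'End(V)) : K :=
  \tr (passmx.mxof (vbasis {:V}) (vbasis {:V}) f).

(* Finite-dimensional unital associative algebras; not a falgType, because    *)
(* the algebra instances of the library exclude the zero algebra.             *)
Record fdAlgebra (K : fieldType) := FdAlgebra {
  fda_vect : vectType K;
  fda_mul : fda_vect -> fda_vect -> fda_vect;
  fda_one : fda_vect;
  fda_mulA : associative fda_mul;
  fda_mul1l : left_id fda_one fda_mul;
  fda_mul1r : right_id fda_one fda_mul;
  fda_mulDl : left_distributive fda_mul +%R;
  fda_mulDr : right_distributive fda_mul +%R;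
  fda_scaleAl : forall k a b, k *: fda_mul a b = fda_mul (k *: a) b;
  fda_scaleAr : forall k a b, k *: fda_mul a b = fda_mul a (k *: b)
}.

Definition fda_sort (K : fieldType) (A : fdAlgebra K) : Type := fda_vect A.
Coercion fda_sort : fdAlgebra >-> Sortclass.

HB.instance Definition _ (K : fieldType) (A : fdAlgebra K) :=
  Vector.on (fda_sort A).
Coercion Defs_fda_sort__canonical__vector_Vector : fdAlgebra >-> Vector.type.
HB.instance Definition _ (K : fieldType) (A : fdAlgebra K) :=
  GRing.Zmodule_isPzRing.Build (fda_sort A) (@fda_mulA K A) (@fda_mul1l K A)
    (@fda_mul1r K A) (@fda_mulDl K A) (@fda_mulDr K A).

Lemma fdalg_scaleAl (K : fieldType) (A : fdAlgebra K) (k : K) (a b : A) :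
  k *: (a * b) = (k *: a) * b.
Proof. exact: fda_scaleAl. Qed.

Lemma fdalg_scaleAr (K : fieldType) (A : fdAlgebra K) (k : K) (a b : A) :
  k *: (a * b) = a * (k *: b).
Proof. exact: fda_scaleAr. Qed.

(******************************************************************************)
(* Tensor products: V (x) W is modelled as Hom(V^*, W), where v (x) w is the  *)
(* map phi |-> phi(v) w; tens_liftE and tens_hom_ext are its universal        *)
(* property.                                                                  *)
(******************************************************************************)

Definition tensv (K : fieldType) (V W : vectType K) : Type :=
  'Hom('Hom(V, K^o), W).
HB.instance Definition _ (K : fieldType) (V W : vectType K) :=
  Vector.on (tensv V W).

Section Tensor.
Variable K : fieldType.
Implicit Types U V W X Y : vectType K.

Definition tens V W (v : V) (w : W) : tensv V W :=
  linfun (fun phi : 'Hom(V, K^o) => (phi v : K) *: w).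

Definition tens_lift V W X (b : V -> W -> X) : 'Hom(tensv V W, X) :=
  linfun (fun t : tensv V W => \sum_(i < \dim {:V})
    b (vbasis {:V})`_i ((t : 'Hom('Hom(V, K^o), W))
                          (linfun (coord (vbasis {:V}) i : V -> K^o)))).

Lemma tensE V W (v : V) (w : W) (phi : 'Hom(V, K^o)) :
  (tens v w : 'Hom('Hom(V, K^o), W)) phi = (phi v : K) *: w.
Proof.
rewrite linfunE // => k f g.
by rewrite add_lfunE scale_lfunE scalerDl scalerA.
Qed.

Lemma tens_linear_l V W (w : W) : linear ((@tens V W)^~ w).
Proof.
move=> k u v; apply/lfunP => phi; rewrite /tens.
rewrite [LHS]tensE.
rewrite [RHS]add_lfunE scale_lfunE [X in _ = _ *: X + _]tensE.
by rewrite [X in _ = _ + X]tensE linearP scalerDl scalerA.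
Qed.

Lemma tens_linear_r V W (v : V) : linear (@tens V W v).
Proof.
move=> k u w; apply/lfunP => phi.
rewrite [LHS]tensE.
rewrite [RHS]add_lfunE scale_lfunE [X in _ = _ *: X + _]tensE.
rewrite [X in _ = _ + X]tensE scalerDr !scalerA.
by rewrite mulrC.
Qed.

Lemma tens_lift_linear V W X (b : V -> W -> X) : (forall v, linear (b v)) ->
  linear (fun t : tensv V W => \sum_(i < \dim {:V})
    b (vbasis {:V})`_i ((t : 'Hom('Hom(V, K^o), W))
                          (linfun (coord (vbasis {:V}) i : V -> K^o)))).
Proof.
move=> b_lin k s t; rewrite scaler_sumr -big_split /=; apply: eq_bigr => i _.
by rewrite [X in b _ X]add_lfunE scale_lfunE b_lin.
Qed.

Lemma tens_liftE V W X (b : V -> W -> X) :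
    (forall w, linear (b^~ w)) -> (forall v, linear (b v)) ->
  forall v w, tens_lift b (tens v w) = b v w.
Proof.
move=> bl br v w; rewrite linfunE; last exact: tens_lift_linear.
pose m := GRing.isLinear.Build K V X _ (b^~ w) (bl w).
pose F : {linear V -> X} := HB.pack (b^~ w) m.
rewrite [in RHS](coord_vbasis (memvf v)) -[RHS]/(F _) linear_sum /=.
apply: eq_bigr => i _; rewrite tensE linfunE; last exact: linearP.
pose m' := GRing.isLinear.Build K W X _ (b (vbasis {:V})`_i) (br _).
pose F' : {linear W -> X} := HB.pack (b (vbasis {:V})`_i) m'.
by rewrite -[LHS]/(F' _) linearZ -[RHS]/(F _) linearZ.
Qed.

Lemma tens_span V W (t : tensv V W) : t = \sum_(i < \dim {:V})
  tens (vbasis {:V})`_i ((t : 'Hom('Hom(V, K^o), W))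
                          (linfun (coord (vbasis {:V}) i : V -> K^o))).
Proof.
apply/lfunP => phi; rewrite sum_lfunE.
transitivity (\sum_(i < \dim {:V}) (phi (vbasis {:V})`_i : K) *:
  (t : 'Hom('Hom(V, K^o), W)) (linfun (coord (vbasis {:V}) i : V -> K^o))).
  under eq_bigr do rewrite -linearZ.
  rewrite -linear_sum; congr (fun_of_lfun _ _); apply/lfunP => v.
  rewrite sum_lfunE {1}(coord_vbasis (memvf v)) linear_sum /=.
  apply: eq_bigr => i _; rewrite scale_lfunE linfunE; last exact: linearP.
  by rewrite linearZ /= [LHS]mulrC.
by apply: eq_bigr => i _; rewrite tensE.
Qed.

Lemma tens_hom_ext V W X (f g : 'Hom(tensv V W, X)) :
  (forall v w, f (tens v w) = g (tens v w)) -> f = g.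
Proof.
move=> efg; apply/lfunP => t; rewrite (tens_span t) !linear_sum.
by apply: eq_bigr => i _; apply: efg.
Qed.

Definition tens_map V W X Y (f : 'Hom(V, X)) (g : 'Hom(W, Y)) :
  'Hom(tensv V W, tensv X Y) := tens_lift (fun v w => tens (f v) (g w)).

Definition tens_swap V W : 'Hom(tensv V W, tensv W V) :=
  tens_lift (fun v w => tens w v).

Definition tens_assoc U V W :
    'Hom(tensv (tensv U V) W, tensv U (tensv V W)) :=
  tens_lift (fun t w => tens_lift (fun u v => tens u (tens v w)) t).

Lemma tens_mapE V W X Y (f : 'Hom(V, X)) (g : 'Hom(W, Y)) v w :
  tens_map f g (tens v w) = tens (f v) (g w).
Proof.
rewrite tens_liftE //= => x k u u'.
  by rewrite linearP tens_linear_l.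
by rewrite linearP tens_linear_r.
Qed.

Lemma tens_swapE V W (v : V) (w : W) : tens_swap V W (tens v w) = tens w v.
Proof.
by rewrite tens_liftE //= => x; [apply: tens_linear_r | apply: tens_linear_l].
Qed.

Lemma tens_assocE U V W (u : U) (v : V) (w : W) :
  tens_assoc U V W (tens (tens u v) w) = tens u (tens v w).
Proof.
have inE x a b : tens_lift (fun u v => tens u (tens v x)) (tens a b)
    = tens a (tens b x) :> tensv U (tensv V W).
  rewrite tens_liftE // => y; first exact: tens_linear_l.
  by move=> k z z'; rewrite tens_linear_l tens_linear_r.
rewrite tens_liftE ?inE // => [x k s t|s k x y]; first exact: linearP.
set f := tens_lift _; set g := tens_lift _; set h := tens_lift _.
suff -> : f = k *: g + h by rewrite add_lfunE scale_lfunE.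
apply: tens_hom_ext => a b.
by rewrite add_lfunE scale_lfunE !inE !tens_linear_r.
Qed.

End Tensor.

Definition dsum (K : fieldType) (I : finType) (V : I -> vectType K) : Type :=
  {dffun forall i, V i}.

Section DirectSum.
Variables (K : fieldType) (I : finType) (V : I -> vectType K).
Local Notation S := (dsum V).

HB.instance Definition _ := Choice.on S.

Definition dsum_mk (f : forall i, V i) : S := [ffun i => f i].

Lemma dsum_mkE f i : dsum_mk f i = f i. Proof. exact: ffunE. Qed.

Definition dsum_zero : S := dsum_mk (fun=> 0).
Definition dsum_opp (x : S) : S := dsum_mk (fun i => - x i).
Definition dsum_add (x y : S) : S := dsum_mk (fun i => x i + y i).
Definition dsum_scale (k : K) (x : S) : S := dsum_mk (fun i => k *: x i).

Fact dsum_addA : associative dsum_add.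
Proof. by move=> x y z; apply/ffunP => i; rewrite !dsum_mkE addrA. Qed.
Fact dsum_addC : commutative dsum_add.
Proof. by move=> x y; apply/ffunP => i; rewrite !dsum_mkE addrC. Qed.
Fact dsum_add0 : left_id dsum_zero dsum_add.
Proof. by move=> x; apply/ffunP => i; rewrite !dsum_mkE add0r. Qed.
Fact dsum_addN : left_inverse dsum_zero dsum_opp dsum_add.
Proof. by move=> x; apply/ffunP => i; rewrite !dsum_mkE addNr. Qed.
HB.instance Definition _ :=
  GRing.isZmodule.Build S dsum_addA dsum_addC dsum_add0 dsum_addN.

Fact dsum_scaleA a b x :
  dsum_scale a (dsum_scale b x) = dsum_scale (a * b) x.
Proof. by apply/ffunP => i; rewrite !dsum_mkE scalerA. Qed.
Fact dsum_scale1 : left_id 1 dsum_scale.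
Proof. by move=> x; apply/ffunP => i; rewrite !dsum_mkE scale1r. Qed.
Fact dsum_scaleDr : right_distributive dsum_scale +%R.
Proof. by move=> a x y; apply/ffunP => i; rewrite !dsum_mkE scalerDr. Qed.
Fact dsum_scaleDl x : {morph dsum_scale^~ x : a b / a + b}.
Proof. by move=> a b; apply/ffunP => i; rewrite !dsum_mkE scalerDl. Qed.
HB.instance Definition _ := GRing.Zmodule_isLmodule.Build K S
  dsum_scaleA dsum_scale1 dsum_scaleDr dsum_scaleDl.

Fact dsum_vect_axiom :
  Vector.axiom (\sum_(j < #|I|) dim (V (enum_val j))) S.
Proof.
pose to (x : S) := \mxrow_(j < #|I|) v2r (x (enum_val j)).
pose from (w : 'rV[K]_(\sum_(j < #|I|) dim (V (enum_val j)))) : S :=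
  dsum_mk (fun i => ecast i (V i) (enum_rankK i)
     (r2v (submxrow w (enum_rank i)))).
exists to => [k x y|].
  apply/mxrowP => j; rewrite mxrowK.
  have -> : submxrow (k *: to x + to y) j
      = k *: submxrow (to x) j + submxrow (to y) j.
    by apply/matrixP => a b; rewrite !mxE.
  by rewrite !mxrowK [(k *: x + y) _]dsum_mkE dsum_mkE linearP.
exists from => [x|w].
  apply/ffunP => i; rewrite dsum_mkE mxrowK v2rK.
  have castE i' (e : i' = i) : ecast i (V i) e (x i') = x i by case: i / e.
  exact: castE.
apply/mxrowP => j; rewrite mxrowK dsum_mkE.
move: (enum_rankK _); move: (enum_valK j); move: (enum_rank _) => j' ej.
by case: j / ej => e; rewrite (eq_irrelevance e erefl) /= r2vK.
Qed.
HB.instance Definition _ := Lmodule_hasFinDim.Build K S dsum_vect_axiom.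

Definition dinj (i : I) : 'Hom(V i, S) :=
  linfun (fun v : V i => dsum_mk (dfwith (fun j => 0 : V j) v)).

Definition dproj (i : I) : 'Hom(S, V i) := linfun (fun x : S => x i).

Definition dcomp (i : I) : {vspace S} := limg (dinj i).

Lemma dprojE i x : dproj i x = x i.
Proof. by rewrite linfunE // => k y z; rewrite [LHS]dsum_mkE dsum_mkE. Qed.

Lemma dinjE i v : dinj i v = dsum_mk (dfwith (fun j => 0 : V j) v).
Proof.
rewrite linfunE // => k u w; apply/ffunP => j.
rewrite [RHS]dsum_mkE !dsum_mkE.
have [->|ne_ji] := eqVneq j i; first by rewrite !dfwith_in.
by rewrite !dfwith_out 1?eq_sym // scaler0 addr0.
Qed.

Lemma dinjK i v : dproj i (dinj i v) = v.
Proof. by rewrite dprojE dinjE dsum_mkE dfwith_in. Qed.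

Lemma dproj_dinj0 i j v : i != j -> dproj j (dinj i v) = 0.
Proof. by move=> ij; rewrite dprojE dinjE dsum_mkE dfwith_out. Qed.

Lemma dsum_decomp x : x = \sum_i dinj i (dproj i x).
Proof.
apply/ffunP => j; rewrite -[LHS]dprojE -[RHS]dprojE linear_sum (bigD1 j) //=.
rewrite dinjK big1 ?addr0 // => i ne_ij.
by rewrite dproj_dinj0.
Qed.

End DirectSum.

Definition quotv (K : fieldType) (V : vectType K) (U : {vspace V}) : Type :=
  Quotient.quot (pred_of_vspace U).

Section QuotientSpace.
Local Open Scope quotient_scope.
Local Notation repr := generic_quotient.repr.
Variables (K : fieldType) (V : vectType K) (U : {vspace V}).
Local Notation Q := (quotv U).

HB.instance Definition _ := ZmodQuotient.on Q.

Lemma quotv_eqP (x y : V) : (\pi_Q x = \pi_Q y) <-> (x - y \in U).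
Proof.
by split=> [/eqP|h]; [|apply/eqP]; rewrite -Quotient.idealrBE.
Qed.

Definition quotv_scale (k : K) (q : Q) : Q := \pi_Q (k *: repr q).

Lemma quotv_scaleE k x : quotv_scale k (\pi_Q x) = \pi_Q (k *: x).
Proof.
apply/quotv_eqP; rewrite -scalerBr rpredZ //.
by apply/quotv_eqP; rewrite reprK.
Qed.

Fact quotv_scaleA a b x :
  quotv_scale a (quotv_scale b x) = quotv_scale (a * b) x.
Proof.
by elim/quotW: x => x; rewrite (quotv_scaleE b x) !quotv_scaleE scalerA.
Qed.
Fact quotv_scale1 : left_id 1 quotv_scale.
Proof. by elim/quotW => x; rewrite quotv_scaleE scale1r. Qed.
Fact quotv_scaleDr : right_distributive quotv_scale +%R.
Proof.
move=> a; elim/quotW => x; elim/quotW => y.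
by rewrite -raddfD !quotv_scaleE -raddfD scalerDr.
Qed.
Fact quotv_scaleDl x : {morph quotv_scale^~ x : a b / a + b}.
Proof.
by move=> a b; elim/quotW: x => x; rewrite !quotv_scaleE -raddfD scalerDl.
Qed.
HB.instance Definition _ := GRing.Zmodule_isLmodule.Build K Q
  quotv_scaleA quotv_scale1 quotv_scaleDr quotv_scaleDl.

Fact quotv_vect_axiom : Vector.axiom (dim (subvs_of U^C)) Q.
Proof.
pose pr x := x - projv U x.
have prU x : pr x \in (U^C)%VS by apply: memv_projC.
have pr_lin k x y : pr (k *: x + y) = k *: pr x + pr y.
  by rewrite /pr linearP scalerBr opprD addrACA.
pose sec (q : Q) : subvs_of U^C := vsproj _ (pr (repr q)).
have pr0 x : x \in U -> pr x = 0 by move=> xU; rewrite /pr projv_id ?subrr.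
have secE x : sec (\pi_Q x) = vsproj _ (pr x).
  have xU : repr (\pi_Q x) - x \in U by apply/quotv_eqP; rewrite reprK.
  rewrite /sec -{1}(subrK x (repr _)) -[repr _ - x]scale1r pr_lin.
  by rewrite scale1r pr0 // add0r.
have sec_lin : linear sec.
  move=> k; elim/quotW => q; elim/quotW => q'.
  by rewrite [k *: _]quotv_scaleE -raddfD !secE pr_lin linearP.
exists (fun q => v2r (sec q)) => [k q q'|]; first by rewrite sec_lin linearP.
exists (fun w => \pi_Q (vsval (r2v w))) => [q|w].
  rewrite v2rK vsprojK // -[RHS]reprK; apply/quotv_eqP.
  by rewrite /pr addrC addrA addNr add0r rpredN memv_proj.
rewrite secE.
have projC0 (u : subvs_of U^C) : projv U (vsval u) = 0.
  have uUC := subvsP u.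
  apply/eqP; rewrite -memv0 -(capv_compl U) memv_cap memv_proj.
  by rewrite -[projv U _](subKr (vsval u)) rpredB ?memv_projC.
by rewrite /pr projC0 subr0 vsvalK r2vK.
Qed.
HB.instance Definition _ := Lmodule_hasFinDim.Build K Q quotv_vect_axiom.

Definition quotv_pi : 'Hom(V, Q) := linfun \pi_Q.

Lemma quotv_piE x : quotv_pi x = \pi_Q x.
Proof.
by rewrite linfunE // => k u v; rewrite raddfD [k *: \pi_Q u]quotv_scaleE.
Qed.

Lemma quotv_piP x y : (quotv_pi x = quotv_pi y) <-> (x - y \in U).
Proof. by rewrite !quotv_piE; apply: quotv_eqP. Qed.

Lemma quotv_pi_surj (q : Q) : exists x, q = quotv_pi x.
Proof. by exists (repr q); rewrite quotv_piE reprK. Qed.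

End QuotientSpace.

Record catAction (G : finGroupType) (K : fieldType) (A : fdAlgebra K) :=
  CatAction {
  ca_rho : G -> 'End(A);
  ca_rho_bij : forall g, bijective (ca_rho g);
  ca_rho1 : forall g, ca_rho g 1 = 1;
  ca_rhoM : forall g a b, ca_rho g (a * b) = ca_rho g a * ca_rho g b;
  ca_c : G -> G -> A;
  ca_cV : G -> G -> A;
  ca_mulcV : forall g h, ca_c g h * ca_cV g h = 1;
  ca_mulVc : forall g h, ca_cV g h * ca_c g h = 1;
  ca_e : A;
  ca_eV : A;
  ca_muleV : ca_e * ca_eV = 1;
  ca_mulVe : ca_eV * ca_e = 1;
  ca_rho_comp : forall g h a,
    ca_rho g (ca_rho h a) = ca_c g h * ca_rho (g * h)%g a * ca_cV g h;
  ca_rho_unit : forall a, ca_rho 1%g a = ca_e * a * ca_eV;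
  ca_cocycle : forall g h k,
    ca_c g h * ca_c (g * h)%g k = ca_rho g (ca_c h k) * ca_c g (h * k)%g;
  ca_cg1 : forall g, ca_c g 1%g = ca_rho g ca_e;
  ca_c1g : forall g, ca_c 1%g g = ca_e
}.

Record twistedFrobenius (G : finGroupType) (K : fieldType) (A : fdAlgebra K) :=
  TwistedFrobenius {
  tf_action :> catAction G A;
  tf_theta : 'Hom(A, K^o);
  tf_thetaC : forall a b, tf_theta (a * b) = tf_theta (b * a);
  tf_nondeg : forall a, (forall b, tf_theta (a * b) = 0) -> a = 0;
  tf_theta_inv : forall g a, tf_theta (ca_rho tf_action g a) = tf_theta a
}.

(* The sequence xi of pairs represents the tensor \sum_(p <- xi) p.1 (x) p.2. *)
Definition inverse_tensor (K : fieldType) (A : fdAlgebra K)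
    (theta : 'Hom(A, K^o)) (xi : seq (A * A)) : Prop :=
  \sum_(p <- xi) tens p.1 p.2 = \sum_(p <- xi) tens p.2 p.1 /\
  forall a, a = \sum_(p <- xi) (theta (a * p.2) : K) *: p.1.

Lemma inverse_tensor_exists (G : finGroupType) (K : fieldType)
    (A : fdAlgebra K) (F : twistedFrobenius G A) :
  exists xi, inverse_tensor (tf_theta F) xi.
Proof.
set theta := tf_theta F.
have lin_l a : linear (fun b : A => theta (a * b) : K^o).
  by move=> k x y; rewrite mulrDr -fdalg_scaleAr linearP.
have lin_r b : linear (fun a : A => theta (a * b) : K^o).
  by move=> k x y; rewrite mulrDl -fdalg_scaleAl linearP.
pose B : 'Hom(A, 'Hom(A, K^o)) :=
  linfun (fun a : A => linfun (fun b : A => theta (a * b) : K^o)).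
have BE a b : B a b = theta (a * b).
  rewrite linfunE; first by rewrite linfunE.
  move=> k x y; apply/lfunP => z.
  by rewrite add_lfunE scale_lfunE !linfunE //; apply: lin_r.
have kerB : lker B == 0%VS.
  apply/lker0P => x y /lfunP exy; apply/eqP; rewrite -subr_eq0; apply/eqP.
  apply: (tf_nondeg (t := F)) => b; move: (exy b); rewrite !BE => e.
  by rewrite mulrBl linearB /= -/theta e subrr.
have imB : limg B = fullv.
  apply/eqP; rewrite eqEdim subvf /= limg_dim_eq ?(eqP kerB) ?capv0 //.
  by rewrite !dimvf -[dim (hom _ _)]/(dim A * 1)%N muln1.
pose d i := (B^-1)%VF (linfun (coord (vbasis {:A}) i : A -> K^o)).
have dE i a : theta (a * d i) = coord (vbasis {:A}) i a.
  rewrite tf_thetaC -BE limg_lfunVK ?imB ?memvf // linfunE //.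
  exact: linearP.
pose xi := [seq ((vbasis {:A})`_(nat_of_ord i), d i)
            | i <- enum 'I_(\dim {:A})].
have xiE a : a = \sum_(p <- xi) (theta (a * p.2) : K) *: p.1.
  rewrite big_map big_enum /= {1}(coord_vbasis (memvf a)).
  by apply: eq_bigr => i _; rewrite dE.
have xiE' a : a = \sum_(p <- xi) (theta (p.1 * a) : K) *: p.2.
  apply/eqP; rewrite -subr_eq0; apply/eqP; apply: (tf_nondeg (t := F)) => b.
  rewrite mulrBl linearB /= mulr_suml linear_sum /= -/theta.
  rewrite [theta (a * b)]tf_thetaC {1}(xiE b) mulr_suml linear_sum /=.
  rewrite -sumrB big1 // => p _; rewrite -!fdalg_scaleAl !linearZ /=.
  rewrite [theta (p.2 * b)]tf_thetaC.
  by rewrite scalerN; apply/eqP; rewrite subr_eq0; apply/eqP; apply: mulrC.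
exists xi; split => //; apply/lfunP => phi.
have [a ->] : exists a, phi = B a.
  by exists ((B^-1)%VF phi); rewrite limg_lfunVK ?imB ?memvf.
rewrite [LHS]sum_lfunE [RHS]sum_lfunE.
transitivity a; [rewrite [RHS]xiE' | rewrite [LHS]xiE];
  by apply: eq_bigr => p _; rewrite tensE BE // tf_thetaC.
Qed.

Section Hochschild.
Variables (G : finGroupType) (K : fieldType) (A : fdAlgebra K).
Variable F : twistedFrobenius G A.
Local Notation rho := (ca_rho F).
Local Notation c := (ca_c F).
Local Notation cV := (ca_cV F).
Local Notation ce := (ca_e F).
Local Notation ceV := (ca_eV F).

(* The image of c1 (x) c2 |-> c1 c2 - c2 h(c1) is the span of these elements; *)
(* see HH0_relP.                                                              *)
Definition HH0_rel (h : G) : {vspace A} :=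
  limg (tens_lift (fun c1 c2 : A => c1 * c2 - c2 * rho h c1)).

Lemma HH0_relP (h : G) (U : {vspace A}) :
  (HH0_rel h <= U)%VS <-> (forall c1 c2, c1 * c2 - c2 * rho h c1 \in U).
Proof.
have rel_l x : linear (fun c1 : A => c1 * x - x * rho h c1).
  move=> k a b; rewrite linearP mulrDl mulrDr -fdalg_scaleAl -fdalg_scaleAr.
  by rewrite scalerBr opprD addrACA.
have rel_r a : linear (fun x : A => a * x - x * rho h a).
  move=> k x y; rewrite mulrDl mulrDr -fdalg_scaleAl -fdalg_scaleAr.
  by rewrite scalerBr opprD addrACA.
split=> [sU c1 c2|relU].
  apply: (subvP sU).
  pose b (x y : A) : A := x * y - y * rho h x.
  rewrite -[X in X \in _](@tens_liftE K A A A b) //.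
  by apply: memv_img; apply: memvf.
apply/subvP => _ /memv_imgP[t _ ->]; rewrite (tens_span t) linear_sum.
by apply: rpred_sum => i _; rewrite /= tens_liftE.
Qed.

Definition HH0 (h : G) : vectType K := quotv (HH0_rel h).

Definition HH0_cls (h : G) (a : A) : dsum HH0 :=
  dinj HH0 h (quotv_pi (HH0_rel h) a).

Definition HH0_T (h g : G) (a : A) : A :=
  ceV * cV g g^-1%g * rho g a * c g h * c (g * h)%g g^-1%g.

Definition HH0_m (xi : seq (A * A)) (g h : G) (a b : A) : A :=
  \sum_(p <- xi) p.1 * a * rho g (p.2 * b) * c g h.

Definition HH0_D (xi : seq (A * A)) (g h : G) (a : A) :
    tensv (dsum HH0) (dsum HH0) :=
  \sum_(p <- xi) tens (HH0_cls g (a * cV g h * rho g p.1)) (HH0_cls h p.2).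

(* T, m, D and theta are the maps induced on HH_0 by T_h(g), m_{g,h},         *)
(* Delta_{g,h} and a |-> theta (a c_e); the classes span HH_0, so these       *)
(* equations determine them.                                                  *)
Record HH0_induced (xi : seq (A * A)) (T : G -> 'End(dsum HH0))
    (m : 'Hom(tensv (dsum HH0) (dsum HH0), dsum HH0))
    (D : 'Hom(dsum HH0, tensv (dsum HH0) (dsum HH0)))
    (theta : 'Hom(HH0 1%g, K^o)) : Prop := {
  HH0_inducedT : forall g h a,
    T g (HH0_cls h a) = HH0_cls (g * h * g^-1)%g (HH0_T h g a);
  HH0_inducedM : forall g h a b,
    m (tens (HH0_cls g a) (HH0_cls h b)) = HH0_cls (g * h)%g (HH0_m xi g h a b);
  HH0_inducedD : forall k a,
    D (HH0_cls k a) = \sum_(gh : G * G | (gh.1 * gh.2)%g == k)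
      HH0_D xi gh.1 gh.2 a;
  HH0_induced_theta : forall a,
    theta (quotv_pi (HH0_rel 1%g) a) = tf_theta F (a * ce)
}.

End Hochschild.

Section WeakCrossed.
Variables (G : finGroupType) (K : fieldType) (V : G -> vectType K).
Local Notation C := (dsum V).
Variables (act : G -> 'End(C)) (mul : 'Hom(tensv C C, C)).
Variables (comul : 'Hom(C, tensv C C)) (theta : 'Hom(V 1%g, K^o)).

Local Notation "x ** y" := (mul (tens x y)) (at level 40, left associativity).

Definition wc_lmul (x : C) : 'End(C) := linfun (fun y => x ** y).
Definition wc_rmul (x : C) : 'End(C) := linfun (fun y => y ** x).

Definition wc_actc (g h k : G) : 'Hom(V h, V k) :=
  (dproj V k \o act g \o dinj V h)%VF.

Definition wc_lmulc (x : C) (h k : G) : 'Hom(V h, V k) :=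
  (dproj V k \o wc_lmul x \o dinj V h)%VF.

(* On dinj V (g * h) x this is Delta_{g,h} x; defining it on all of C avoids  *)
(* transporting along equalities such as h * (h^-1 * g * h) = g * h.          *)
Definition wc_comulc (g h : G) : 'Hom(C, tensv (V g) (V h)) :=
  (tens_map (dproj V g) (dproj V h) \o comul)%VF.

Record weak_crossed : Prop := {
  wc_act1 : act 1%g = \1%VF;
  wc_actM : forall g h, act (g * h)%g = (act g \o act h)%VF;
  wc_act_comp : forall g h,
    (act g @: dcomp V h)%VS = dcomp V (g * h * g^-1)%g;
  wc_act_id : forall g, {in dcomp V g, forall x, act g x = x};
  wc_theta_inv : forall g (x : V 1%g), theta (wc_actc g 1%g 1%g x) = theta x;
  wc_mulA : forall x y z, x ** y ** z = x ** (y ** z);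
  wc_comulA : (tens_assoc C C C \o tens_map comul \1 \o comul)%VF
    = (tens_map \1 comul \o comul)%VF;
  wc_act_mul : forall g x y, act g (x ** y) = act g x ** act g y;
  wc_mul_comp : forall g h,
    {in dcomp V g & dcomp V h, forall x y, x ** y \in dcomp V (g * h)%g};
  wc_mul_comm : forall g h,
    {in dcomp V g & dcomp V h, forall x y, x ** y = act g y ** x};
  wc_torus : forall g h,
    {in dcomp V (h * g * h^-1 * g^-1)%g, forall x,
      lftrace (wc_lmulc x (g * h * g^-1)%g h \o wc_actc g h (g * h * g^-1)%g)
      = lftrace (wc_actc h^-1%g (h * g * h^-1)%g g
                 \o wc_lmulc x g (h * g * h^-1)%g)};
  wc_act_comul : forall g,
    (tens_map (act g) (act g) \o comul)%VF = (comul \o act g)%VF;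
  wc_comul_comp : forall k, {in dcomp V k, forall x, comul x \in
    (\sum_(gh : G * G | (gh.1 * gh.2)%g == k)
      limg (tens_map (dinj V gh.1) (dinj V gh.2)))%VS};
  wc_comul_comm : forall g h, {in dcomp V (g * h)%g, forall x,
    wc_comulc g h x = tens_swap (V h) (V g)
      (tens_map \1 (wc_actc h (h^-1 * g * h)%g g)
        (wc_comulc h (h^-1 * g * h)%g x))};
  wc_counit_l : forall g (x : V g),
    tens_lift (fun (a : V 1%g) (b : V g) => (theta a : K) *: b)
      (wc_comulc 1%g g (dinj V g x)) = x;
  wc_counit_r : forall g (x : V g),
    tens_lift (fun (a : V g) (b : V 1%g) => (theta b : K) *: a)
      (wc_comulc g 1%g (dinj V g x)) = x;
  wc_comul_lmul : forall x y,
    comul (x ** y) = tens_map (wc_lmul x) \1 (comul y);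
  wc_comul_rmul : forall x y,
    comul (x ** y) = tens_map \1 (wc_rmul y) (comul x)
}.

End WeakCrossed.

(* Main.v *)
Require Import Defs.
From HB Require Import structures.
From mathcomp Require Import all_boot all_fingroup all_order all_algebra.

(* In the crossed product B = (+)_g A u_g, with u_g a = g(a) u_g and          *)
(* u_g u_h = c_{g,h} u_{gh}, one has HH_0(A)_h = A u_h / [A, A u_h]; hence    *)
(* HH_0(A) = B / [A, B].  In these terms T(g) is conjugation by u_g, the      *)
(* product of x and y is \sum_i xi'_i x xi''_i y, and the coproduct of x is   *)
(* x Xi, where Xi = \sum_(h, i) u_h^-1 xi'_i (x) xi''_i u_h.  The axioms then *)
(* follow from a xi = xi a for a in A, the symmetry and G-invariance of xi,   *)
(* and the corresponding identity b Xi = Xi b (b in B) and symmetry of Xi.    *)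
(* For the torus axiom, y |-> \sum_i xi''_i y xi'_i vanishes on [A, B], so    *)
(* both operators factor through the projection A -> HH_0(A)_h and their      *)
(* traces are traces on A, which xi computes.                                 *)

Set Implicit Arguments.
Unset Strict Implicit.
Unset Printing Implicit Defensive.

Import GRing.Theory.
Local Open Scope ring_scope.

(** Identities in HH_0(A) = B / [A, B] are checked on representatives in B: under the class map [cl]
    a factor from A may be rotated cyclically ([cl_comm]), and a linear map on B descends once it
    kills [A, B] ([cl_ker]). What remains is moving factors between the two legs of a tensor. For xi
    this is [xi_bal], [xi_bal'] and [xi_rho]: expanding a leg by means of the pairing turns them
    into cyclicity and G-invariance of theta. The functional [tr] extends theta to a symmetric trace
    on B ([trC]), and Xi is the tensor inverse to its pairing; hence Xi satisfies the same rules for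
    all b in B ([Xi_bal], [Xi_sym], [Xi_bal']). Associativity is then one shift in xi,
    coassociativity one shift in Xi; equivariance, crossed commutativity and the bimodule property
    need a few shifts each. For the torus axiom, [lftrace_HH0] turns both traces into sums over xi
    of values of [tr], which shifts identify. *)

Definition crossed (G : finGroupType) (K : fieldType) (A : fdAlgebra K)
  (F : catAction G A) : Type := dsum (fun _ : G => A : vectType K).
HB.instance Definition _ (G : finGroupType) (K : fieldType) (A : fdAlgebra K)
  (F : catAction G A) := Vector.on (crossed F).

(** * The crossed product B of A with G *)

Section CrossedProduct.
Variables (G : finGroupType) (K : fieldType) (A : fdAlgebra K).
Variable F : catAction G A.
Local Notation crossed := (crossed F).
Local Notation rho := (ca_rho F).
Local Notation c := (ca_c F).
Local Notation cV := (ca_cV F).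
Local Notation ce := (ca_e F).
Local Notation ceV := (ca_eV F).

(* The element a u_g. *)
Definition cr_mon (g : G) (a : A) : crossed :=
  dinj (fun _ : G => A : vectType K) g a.
Definition coef (g : G) (x : crossed) : A :=
  dproj (fun _ : G => A : vectType K) g x.

Fact mon_linear g : linear (cr_mon g). Proof. exact: linearP. Qed.
HB.instance Definition _ g := GRing.isLinear.Build K A crossed _ (cr_mon g)
  (mon_linear g).
Fact coef_linear g : linear (coef g). Proof. exact: linearP. Qed.
HB.instance Definition _ g := GRing.isLinear.Build K crossed A _ (coef g)
  (coef_linear g).

Lemma monD g : {morph cr_mon g : a b / a + b}. Proof. exact: raddfD. Qed.
Lemma mon0 g : cr_mon g 0 = 0. Proof. exact: (raddf0 (cr_mon g)). Qed.
Lemma monZ g k a : cr_mon g (k *: a) = k *: cr_mon g a.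
Proof. by rewrite linearZ. Qed.

Lemma coef_mon g a h : coef h (cr_mon g a) = if g == h then a else 0.
Proof.
rewrite /coef /cr_mon; have [<-|ne] := eqVneq g h; first exact: dinjK.
exact: dproj_dinj0.
Qed.

Lemma crossed_sum (x : crossed) : x = \sum_g cr_mon g (coef g x).
Proof. exact: dsum_decomp. Qed.

Definition cmul (x y : crossed) : crossed := \sum_g \sum_h
  cr_mon (g * h)%g (coef g x * rho g (coef h y) * c g h).
Definition cone : crossed := cr_mon 1%g ceV.

Lemma cmulDl : left_distributive cmul +%R.
Proof.
move=> x y z; rewrite /cmul -big_split; apply: eq_bigr => g _ /=.
rewrite -big_split; apply: eq_bigr => h _ /=.
by rewrite raddfD !mulrDl monD.
Qed.

Lemma cmulDr : right_distributive cmul +%R.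
Proof.
move=> x y z; rewrite /cmul -big_split; apply: eq_bigr => g _ /=.
rewrite -big_split; apply: eq_bigr => h _ /=.
by rewrite !raddfD mulrDr !mulrDl monD.
Qed.

Lemma cmul_mon a g b h : cmul (cr_mon g a) (cr_mon h b)
  = cr_mon (g * h)%g (a * rho g b * c g h).
Proof.
rewrite /cmul (bigD1 g) //= (bigD1 h) //= !coef_mon !eqxx !big1 ?addr0 //.
  move=> k ne; rewrite big1 // => l _.
  by rewrite coef_mon eq_sym (negPf ne) !mul0r mon0.
by move=> k ne; rewrite coef_mon eq_sym (negPf ne) linear0 mulr0 mul0r mon0.
Qed.

Lemma crossed_ind (P : crossed -> Prop) :
  (forall x y, P x -> P y -> P (x + y)) -> (forall a g, P (cr_mon g a)) ->
  forall x, P x.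
Proof.
move=> PD Pm x; rewrite (crossed_sum x); elim/big_rec: _ => [|g y _ Py].
  by rewrite -(mon0 1%g).
exact: PD.
Qed.

(** On monomials, g(h(d)) = c_{g,h} gh(d) c_{g,h}^-1, and the factor c_{g,h}^-1 then cancels by the
    cocycle identity. *)
Lemma cmulA : associative cmul.
Proof.
move=> x y z.
elim/crossed_ind: x => [x x' Px Px'|a g]; first by rewrite !cmulDl Px Px'.
elim/crossed_ind: y => [y y' Py Py'|b h].
  by rewrite cmulDl !cmulDr cmulDl Py Py'.
elim/crossed_ind: z => [z z' Pz Pz'|d k]; first by rewrite !cmulDr Pz Pz'.
rewrite !cmul_mon mulgA; congr cr_mon.
rewrite !ca_rhoM ca_rho_comp -!mulrA; congr (_ * (_ * _)).
by rewrite -ca_cocycle [cV g h * _]mulrA ca_mulVc mul1r.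
Qed.

Lemma cmul1l : left_id cone cmul.
Proof.
elim/crossed_ind => [x y Px Py|b h]; first by rewrite cmulDr Px Py.
rewrite cmul_mon mul1g ca_rho_unit ca_c1g.
by rewrite !mulrA ca_mulVe mul1r -mulrA ca_mulVe mulr1.
Qed.

Lemma cmul1r : right_id cone cmul.
Proof.
elim/crossed_ind => [x y Px Py|b h]; first by rewrite cmulDl Px Py.
by rewrite cmul_mon mulg1 ca_cg1 -mulrA -ca_rhoM ca_mulVe ca_rho1 mulr1.
Qed.

HB.instance Definition _ := GRing.Zmodule_isPzRing.Build crossed
  cmulA cmul1l cmul1r cmulDl cmulDr.

Implicit Types x y z : crossed.

Lemma monM a g b h :
  cr_mon g a * cr_mon h b = cr_mon (g * h)%g (a * rho g b * c g h).
Proof. exact: cmul_mon. Qed.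

Lemma crossed_scaleAl k x y : k *: (x * y) = (k *: x) * y.
Proof.
elim/crossed_ind: x => [x x' Px Px'|a g].
  by rewrite mulrDl !scalerDr mulrDl Px Px'.
elim/crossed_ind: y => [y y' Py Py'|b h].
  by rewrite !mulrDr scalerDr Py Py'.
by rewrite -monZ !monM -monZ !fdalg_scaleAl.
Qed.

Lemma crossed_scaleAr k x y : k *: (x * y) = x * (k *: y).
Proof.
elim/crossed_ind: x => [x x' Px Px'|a g].
  by rewrite !mulrDl !scalerDr Px Px'.
elim/crossed_ind: y => [y y' Py Py'|b h].
  by rewrite !(mulrDr, scalerDr) Py Py'.
rewrite -monZ !monM -monZ; congr cr_mon.
by rewrite linearZ fdalg_scaleAl fdalg_scaleAr.
Qed.

(* The unit of B is c_e^-1 u_e, not u_e. *)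
Definition cr_emb (a : A) : crossed := cr_mon 1%g (a * ceV).
Definition cr_u (g : G) : crossed := cr_mon g 1.
(* Locked, because otherwise rewriting with mulrA would split it. *)
Definition cr_uV (g : G) : crossed :=
  locked (cr_u g^-1%g * cr_emb (ceV * cV g g^-1%g)).

Lemma uVE g : cr_uV g = cr_u g^-1%g * cr_emb (ceV * cV g g^-1%g).
Proof. by rewrite /cr_uV -lock. Qed.

Lemma mul_emb_mon a b h : cr_emb a * cr_mon h b = cr_mon h (a * b).
Proof.
rewrite /cr_emb monM mul1g ca_rho_unit ca_c1g; congr cr_mon.
by rewrite !mulrA -[a * _ * _]mulrA ca_mulVe mulr1 -mulrA ca_mulVe mulr1.
Qed.

Lemma mul_mon_emb a b h : cr_mon h b * cr_emb a = cr_mon h (b * rho h a).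
Proof.
rewrite /cr_emb monM mulg1 ca_cg1 ca_rhoM -!mulrA -ca_rhoM ca_mulVe.
by rewrite ca_rho1 mulr1.
Qed.

Lemma monE g a : cr_mon g a = cr_emb a * cr_u g.
Proof. by rewrite mul_emb_mon mulr1. Qed.

Fact emb_linear : linear cr_emb.
Proof. by move=> k a b; rewrite /cr_emb mulrDl -fdalg_scaleAl monD monZ. Qed.
HB.instance Definition _ :=
  GRing.isLinear.Build K A crossed _ cr_emb emb_linear.

Lemma embM a b : cr_emb (a * b) = cr_emb a * cr_emb b.
Proof. by rewrite [cr_emb b]/cr_emb mul_emb_mon mulrA. Qed.

Lemma emb1 : cr_emb 1 = 1. Proof. by rewrite /cr_emb mul1r. Qed.

Lemma u_emb g a : cr_u g * cr_emb a = cr_emb (rho g a) * cr_u g.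
Proof. by rewrite mul_emb_mon mul_mon_emb mulr1 mul1r. Qed.

Lemma u_mul g h : cr_u g * cr_u h = cr_emb (c g h) * cr_u (g * h)%g.
Proof. by rewrite monM mul_emb_mon ca_rho1 !mul1r mulr1. Qed.

Lemma u_1 : cr_u 1%g = cr_emb ce.
Proof. by rewrite /cr_emb ca_muleV. Qed.

Lemma u_uV g : cr_u g * cr_uV g = 1.
Proof.
rewrite uVE mulrA u_mul mulgV u_1 -!embM mulrA -[c _ _ * _ * _]mulrA.
by rewrite ca_muleV mulr1 ca_mulcV emb1.
Qed.

(** By [u_uV], [cr_uV g] is a right inverse of [cr_u g]. It has a right inverse of its own, being
    u_{g^-1} times a unit of A, so it is a two-sided inverse. *)
Lemma uV_u g : cr_uV g * cr_u g = 1.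
Proof.
have [r rE] : exists r, cr_uV g * r = 1.
  exists (cr_emb (c g g^-1%g * ce) * cr_uV g^-1%g).
  rewrite uVE mulrA -[_ * cr_emb _ * cr_emb _]mulrA -embM -mulrA.
  rewrite [ceV * _ * _]mulrA -[ceV * _ * _]mulrA ca_mulVc mulr1 ca_mulVe.
  by rewrite emb1 mul1r u_uV.
rewrite -[cr_u g in LHS]mulr1 -[X in cr_u g * X]rE !mulrA.
by rewrite -[cr_uV g * cr_u g * _]mulrA u_uV mulr1 rE.
Qed.

End CrossedProduct.

Lemma crossed_mulZl (G : finGroupType) (K : fieldType) (A : fdAlgebra K)
    (F : catAction G A) k (x y z : crossed F) :
  (k *: x + y) * z = k *: (x * z) + y * z.
Proof. by rewrite mulrDl crossed_scaleAl. Qed.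

Lemma crossed_mulZr (G : finGroupType) (K : fieldType) (A : fdAlgebra K)
    (F : catAction G A) k (x y z : crossed F) :
  x * (k *: y + z) = k *: (x * y) + x * z.
Proof. by rewrite mulrDr crossed_scaleAr. Qed.

(** * Linear algebra: bilinear maps, descent along surjections, traces *)

Section Bilinear.
Variable K : fieldType.
Implicit Types U V W : vectType K.

Definition bilin U V W (f : U -> V -> W) : Prop :=
  (forall v, linear (f^~ v)) /\ (forall u, linear (f u)).

Lemma bilin_swap U V W (f : U -> V -> W) :
  bilin f -> bilin (fun v u => f u v).
Proof. by case. Qed.

Lemma linear_sumZ U W (f : U -> W) (lin_f : linear f) I (r : seq I)
    (k : I -> K) (a : I -> U) :
  f (\sum_(i <- r) k i *: a i) = \sum_(i <- r) k i *: f (a i).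
Proof.
pose m := GRing.isLinear.Build K U W _ f lin_f.
pose f' : {linear U -> W} := HB.pack f m.
by rewrite -[f _]/(f' _) linear_sum; apply: eq_bigr => i _; rewrite linearZ.
Qed.

Lemma linear_sum_fun U W I (r : seq I) (P : pred I) (f : I -> U -> W) :
  (forall i, linear (f i)) -> linear (fun x => \sum_(i <- r | P i) f i x).
Proof.
move=> lin_f k x y; rewrite scaler_sumr -big_split.
by apply: eq_bigr => i _; apply: lin_f.
Qed.

Lemma tensPl V W k (v v' : V) (w : W) :
  tens (k *: v + v') w = k *: tens v w + tens v' w.
Proof. exact: tens_linear_l. Qed.

Lemma tensPr V W k (v : V) (w w' : W) :
  tens v (k *: w + w') = k *: tens v w + tens v w'.
Proof. exact: tens_linear_r. Qed.

Lemma tens_suml V W I (r : seq I) (P : pred I) (v : I -> V) (w : W) :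
  tens (\sum_(i <- r | P i) v i) w = \sum_(i <- r | P i) tens (v i) w.
Proof.
pose m := GRing.isLinear.Build K V _ _ ((@tens K V W)^~ w)
  (@tens_linear_l K V W w).
pose f : {linear V -> tensv V W} := HB.pack ((@tens K V W)^~ w) m.
by rewrite -[LHS]/(f _) linear_sum.
Qed.

Lemma tens_sumr V W I (r : seq I) (P : pred I) (v : V) (w : I -> W) :
  tens v (\sum_(i <- r | P i) w i) = \sum_(i <- r | P i) tens v (w i).
Proof.
pose m := GRing.isLinear.Build K W _ _ (@tens K V W v) (@tens_linear_r K V W v).
pose f : {linear W -> tensv V W} := HB.pack (@tens K V W v) m.
by rewrite -[LHS]/(f _) linear_sum.
Qed.

(* As p is surjective, this is the map induced by f as soon as f kills the    *)
(* kernel of p.                                                               *)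
Definition descend U V W (p : 'Hom(U, V)) (f : 'Hom(U, W)) : 'Hom(V, W) :=
  locked (f \o p^-1)%VF.

Lemma descendE U V W (p : 'Hom(U, V)) (f : 'Hom(U, W)) :
  (lker p <= lker f)%VS -> forall x, descend p f (p x) = f x.
Proof.
move=> sub x; rewrite /descend -lock comp_lfunE; apply/eqP.
rewrite -subr_eq0 -linearB -memv_ker; apply: (subvP sub).
by rewrite memv_ker linearB /= limg_lfunVK ?subrr // memv_img ?memvf.
Qed.

Lemma lftraceE V (f : 'End(V)) :
  lftrace f = \sum_(i < \dim {:V}) coord (vbasis {:V}) i (f (vbasis {:V})`_i).
Proof.
apply: eq_bigr => i _; rewrite !mxE /=; congr (coord _ _ (f _)).
by rewrite passmx.vecof_delta.
Qed.

Lemma lftraceC U V (f : 'Hom(U, V)) (g : 'Hom(V, U)) :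
  lftrace (f \o g)%VF = lftrace (g \o f)%VF.
Proof.
rewrite /lftrace (passmx.mxof_comp _ _ (vbasisP _)).
by rewrite mxtrace_mulC -(passmx.mxof_comp _ _ (vbasisP _)).
Qed.

Lemma lftrace_sum_rank1 V (f : 'End(V)) I (r : seq I)
    (phi : I -> 'Hom(V, K^o)) (v : I -> V) :
  (forall x, f x = \sum_(i <- r) (phi i x : K) *: v i) ->
  lftrace f = \sum_(i <- r) (phi i (v i) : K).
Proof.
move=> fE; rewrite lftraceE.
under eq_bigr do rewrite fE linear_sum.
rewrite exchange_big; apply: eq_bigr => i _ /=.
rewrite [v i in RHS](coord_vbasis (memvf _)) linear_sum.
by apply: eq_bigr => j _; rewrite !linearZ /= mulrC.
Qed.

End Bilinear.

(** * The inverse tensor xi of the Frobenius pairing *)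

Section Casimir.
Variables (G : finGroupType) (K : fieldType) (A : fdAlgebra K).
Variables (F : twistedFrobenius G A) (xi : seq (A * A)).
Hypothesis xi_inv : inverse_tensor (tf_theta F) xi.
Local Notation theta := (tf_theta F).
Local Notation rho := (ca_rho F).

Lemma theta_linl (b : A) : linear (fun a : A => theta (a * b) : K^o).
Proof. by move=> k x y; rewrite mulrDl -fdalg_scaleAl linearP. Qed.

Lemma theta_linr (a : A) : linear (fun b : A => theta (a * b) : K^o).
Proof. by move=> k x y; rewrite mulrDr -fdalg_scaleAr linearP. Qed.

Section BilinearSums.
Variables (W : vectType K) (f : A -> A -> W).
Hypothesis f_bilin : bilin f.

Lemma xi_sym : \sum_(p <- xi) f p.1 p.2 = \sum_(p <- xi) f p.2 p.1.
Proof.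
have [fl fr] := f_bilin.
have := congr1 (tens_lift f) xi_inv.1; rewrite !linear_sum /= => e.
transitivity (\sum_(p <- xi) tens_lift f (tens p.1 p.2)).
  by apply: eq_bigr => p _; rewrite tens_liftE.
by rewrite e; apply: eq_bigr => p _; rewrite tens_liftE.
Qed.

End BilinearSums.

Lemma xi_dual (a : A) : \sum_(p <- xi) (theta (a * p.1) : K) *: p.2 = a.
Proof.
rewrite [RHS]xi_inv.2.
apply: (@xi_sym A (fun s t => (theta (a * s) : K) *: t)).
split=> [t k x y|s k x y].
  by rewrite theta_linr scalerDl -scalerA.
by rewrite scalerDr !scalerA mulrC.
Qed.

(** Expanding the first leg by the defining property of xi reduces an identity of tensors to one in
    A for the second leg, which [xi_dual] then settles. *)
Lemma xi_expand (W : vectType K) (f : A -> A -> W) (f_bilin : bilin f)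
    (phi psi : A -> A) :
  \sum_(p <- xi) f (phi p.1) (psi p.2) = \sum_(q <- xi)
    f q.1 (\sum_(p <- xi) (theta (phi p.1 * q.2) : K) *: psi p.2).
Proof.
have [fl fr] := f_bilin.
transitivity (\sum_(p <- xi) \sum_(q <- xi)
    (theta (phi p.1 * q.2) : K) *: f q.1 (psi p.2)).
  apply: eq_bigr => p _; rewrite {1}(xi_inv.2 (phi p.1)).
  exact: (linear_sumZ (fl _)).
rewrite exchange_big; apply: eq_bigr => q _ /=.
by rewrite linear_sumZ.
Qed.

Section Balance.
Variables (W : vectType K) (f : A -> A -> W).
Hypothesis f_bilin : bilin f.

(** After expansion the second leg is \sum theta(a xi' q) xi'' = \sum theta((q a) xi') xi'' = q a,
    by cyclicity of theta. *)
Lemma xi_bal a :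
  \sum_(p <- xi) f (a * p.1) p.2 = \sum_(p <- xi) f p.1 (p.2 * a).
Proof.
rewrite (xi_expand f_bilin (fun s => a * s) id).
apply: eq_bigr => q _ /=; congr f; rewrite -[RHS]xi_dual.
by apply: eq_bigr => p _; rewrite tf_thetaC mulrA.
Qed.

(** An automorphism that preserves theta preserves the pairing, hence also its inverse tensor. *)
Lemma xi_rho g :
  \sum_(p <- xi) f (rho g p.1) (rho g p.2) = \sum_(p <- xi) f p.1 p.2.
Proof.
rewrite (xi_expand f_bilin (rho g) (rho g)).
apply: eq_bigr => q _ /=; congr f.
have [r rK rhoK] := ca_rho_bij F g.
rewrite -{2}[q.2]rhoK -[r q.2 in RHS]xi_dual linear_sum.
apply: eq_bigr => p _ /=; rewrite linearZ /=; congr (_ *: _).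
by rewrite -{1}[q.2]rhoK -ca_rhoM tf_theta_inv tf_thetaC.
Qed.

End Balance.

Lemma xi_bal' (W : vectType K) (f : A -> A -> W) (f_bilin : bilin f) a :
  \sum_(p <- xi) f (p.1 * a) p.2 = \sum_(p <- xi) f p.1 (a * p.2).
Proof.
have [fl fr] := f_bilin.
rewrite [LHS](@xi_sym _ (fun s t => f (s * a) t)).
  rewrite [RHS](@xi_sym _ (fun s t => f s (a * t))).
    by rewrite (xi_bal (bilin_swap f_bilin)).
  by split=> [t|s k x y]; [apply: fl | rewrite mulrDr -fdalg_scaleAr fr].
by split=> [t k x y|s]; [rewrite mulrDl -fdalg_scaleAl fl | apply: fr].
Qed.

(** The expansion f(x) = \sum theta(x xi'') f(xi') writes f as a sum of rank-one maps. *)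
Lemma lftrace_xi (f : 'End(A)) :
  lftrace f = \sum_(p <- xi) (theta (f p.1 * p.2) : K).
Proof.
pose phi b : 'Hom(A, K^o) := linfun (fun a : A => theta (a * b) : K^o).
have phiE b a : phi b a = theta (a * b).
  by rewrite linfunE //; apply: theta_linl.
rewrite (@lftrace_sum_rank1 _ _ _ _ xi (fun p => phi p.2) (fun p => f p.1)).
  by apply: eq_bigr => p _; rewrite phiE.
move=> x; rewrite {1}(xi_inv.2 x) linear_sum.
by apply: eq_bigr => p _; rewrite linearZ phiE.
Qed.

End Casimir.

Ltac lin :=
  cbn beta; rewrite ?(linearP, crossed_mulZl, crossed_mulZr, tensPl, tensPr) //.
Ltac bilin := split=> ? ? ? ?; lin.

(** * The class map from B onto HH_0(A) *)

Section HochschildBundle.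
Variables (G : finGroupType) (K : fieldType) (A : fdAlgebra K).
Variables (F : twistedFrobenius G A) (xi : seq (A * A)).
Hypothesis xi_inv : inverse_tensor (tf_theta F) xi.
Local Notation B := (crossed F).
Local Notation C := (dsum (HH0 F)).
Local Notation theta := (tf_theta F).
Local Notation mon := (cr_mon F).
Local Notation emb := (cr_emb F).
Local Notation u := (cr_u F).
Local Notation uV := (cr_uV F).
Local Notation rho := (ca_rho F).
Local Notation c := (ca_c F).
Local Notation cV := (ca_cV F).
Local Notation ce := (ca_e F).
Local Notation ceV := (ca_eV F).

Definition cl_fun (x : B) : C := \sum_h HH0_cls F h (coef h x).

Lemma HH0_cls_linear h : linear (HH0_cls F h).
Proof. by move=> k x y; rewrite /HH0_cls !linearP. Qed.

Lemma cl_linear : linear cl_fun.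
Proof.
apply: linear_sum_fun => h k x y; rewrite linearP; exact: HH0_cls_linear.
Qed.

Definition cl : 'Hom(B, C) := linfun cl_fun.

Lemma clE x : cl x = \sum_h HH0_cls F h (coef h x).
Proof. rewrite linfunE //; exact: cl_linear. Qed.

Lemma HH0_cls0 h : HH0_cls F h 0 = 0.
Proof. by rewrite /HH0_cls !linear0. Qed.

Lemma dproj_cl h x : dproj (HH0 F) h (cl x) = quotv_pi (HH0_rel F h) (coef h x).
Proof.
rewrite clE linear_sum (bigD1 h) //= dinjK big1 ?addr0 // => g ne.
exact: dproj_dinj0.
Qed.

Lemma cl_mon h a : cl (mon h a) = HH0_cls F h a.
Proof.
rewrite clE (bigD1 h) //= coef_mon eqxx big1 ?addr0 // => g ne.
by rewrite coef_mon eq_sym (negPf ne) HH0_cls0.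
Qed.

Lemma cl_surj (y : C) : exists x, y = cl x.
Proof.
have /fin_all_exists[a aE] : forall h, exists a,
    dproj (HH0 F) h y = quotv_pi (HH0_rel F h) a.
  by move=> h; apply: quotv_pi_surj.
exists (\sum_h mon h (a h)); rewrite linear_sum [LHS]dsum_decomp.
by apply: eq_bigr => h _; rewrite aE /= cl_mon.
Qed.

Lemma cl_limg : limg cl = fullv.
Proof.
apply/eqP; rewrite eqEsubv subvf; apply/subvP => y _.
by have [x ->] := cl_surj y; rewrite memv_img ?memvf.
Qed.

Lemma cl_secK y : cl (cl^-1%VF y) = y.
Proof. by rewrite limg_lfunVK // cl_limg memvf. Qed.

Lemma cl_comm a x : cl (emb a * x) = cl (x * emb a).
Proof.
elim/crossed_ind: x => [x y Px Py|b h].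
  by rewrite mulrDr mulrDl !linearD /= Px Py.
rewrite mul_emb_mon mul_mon_emb !cl_mon; congr (dinj _ _ _).
apply/quotv_piP; exact: (HH0_relP F h _).1 (subvv _) a b.
Qed.

(** The kernel of [cl] is graded, with degree h part spanned by the commutators a (b u_h) - (b u_h)
    a = (a b - b h(a)) u_h. *)
Lemma cl_ker (W : vectType K) (f : 'Hom(B, W)) :
  (forall a x, f (emb a * x) = f (x * emb a)) -> (lker cl <= lker f)%VS.
Proof.
move=> f_comm; apply/subvP => x; rewrite !memv_ker => /eqP clx0.
rewrite (crossed_sum x) linear_sum big1 // => h _.
pose fh : 'Hom(A, W) := linfun (fun a => f (mon h a)).
have fhE a : fh a = f (mon h a).
  by rewrite linfunE // => k b d; rewrite !linearP.
have relU : (HH0_rel F h <= lker fh)%VS.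
  apply/HH0_relP => a b; rewrite memv_ker fhE linearB /= linearB /=.
  by rewrite -mul_emb_mon -mul_mon_emb f_comm subrr.
have : coef h x \in lker fh.
  apply: (subvP relU); rewrite -[X in X \in _]subr0; apply/quotv_piP.
  by rewrite -dproj_cl clx0 !linear0.
by rewrite memv_ker fhE => /eqP.
Qed.

Lemma descend_clE (W : vectType K) (f : 'Hom(B, W)) :
  (forall a x, f (emb a * x) = f (x * emb a)) ->
  forall x, descend cl f (cl x) = f x.
Proof. by move=> f_comm; apply: descendE; apply: cl_ker. Qed.

(** * The trace form on B *)

(** The factor c_e compensates for the unit c_e^-1 u_e of B: with it, [tr] restricts to theta on A
    ([tr_emb]). *)
Definition tr_fun (x : B) : K^o := theta (coef 1%g x * ce).
Lemma tr_linear : linear tr_fun.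
Proof. by move=> k x y; rewrite /tr_fun linearP theta_linl. Qed.
Definition tr : 'Hom(B, K^o) := linfun tr_fun.

Lemma tr_mon g a : tr (mon g a) = if g == 1%g then theta (a * ce) else 0.
Proof.
rewrite linfunE; last exact: tr_linear.
by rewrite /tr_fun coef_mon; case: ifP => // _; rewrite mul0r linear0.
Qed.

Lemma tr_emb a : tr (emb a) = theta a.
Proof. by rewrite tr_mon eqxx -mulrA ca_mulVe mulr1. Qed.

Lemma tr_embC a x : tr (emb a * x) = tr (x * emb a).
Proof.
elim/crossed_ind: x => [x y Px Py|b h].
  by rewrite mulrDr mulrDl !linearD /= Px Py.
rewrite mul_emb_mon mul_mon_emb !tr_mon; case: eqP => // ->.
rewrite ca_rho_unit -!mulrA ca_mulVe mulr1.
by rewrite tf_thetaC !mulrA.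
Qed.

Lemma emb_conj g a : u g * emb a * uV g = emb (rho g a).
Proof. by rewrite u_emb -mulrA u_uV mulr1. Qed.

Lemma mon1E a : mon 1%g a = emb (a * ce).
Proof. by rewrite /cr_emb -mulrA ca_muleV mulr1. Qed.

Lemma tr_conj g x : tr (u g * x * uV g) = tr x.
Proof.
elim/crossed_ind: x => [x y Px Py|b h].
  by rewrite mulrDr mulrDl !linearD /= Px Py.
have [->|ne] := eqVneq h 1%g.
  by rewrite mon1E emb_conj !tr_emb tf_theta_inv.
rewrite [in RHS]tr_mon (negPf ne).
rewrite uVE mulrA monM [mon _ _ * _]monM mul_mon_emb tr_mon -eq_mulgV1.
have -> // : (g * h == g)%g = false.
by rewrite -[X in _ == X]mulg1 (inj_eq (mulgI g)) (negPf ne).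
Qed.

(** B is spanned by products a u_g: a moves around by [tr_embC], and u_g by conjugation invariance
    [tr_conj]. *)
Lemma trC x y : tr (x * y) = tr (y * x).
Proof.
elim/crossed_ind: x => [x x' Px Px'|a g].
  by rewrite mulrDr mulrDl !linearD /= Px Px'.
rewrite monE -mulrA tr_embC -(tr_conj g (y * _)) -!mulrA u_uV mulr1.
by rewrite !mulrA.
Qed.

(** This expresses the trace formula [lftrace_xi] on A, for maps that pick out a coefficient,
    through [tr] on B. *)
Lemma theta_coef h x b : theta (coef h x * b) = tr (x * uV h * emb b).
Proof.
elim/crossed_ind: x => [x y Px Py|a k].
  by rewrite linearD /= !mulrDl !linearD /= Px Py.
rewrite coef_mon; have [->|ne] := eqVneq k h.
  by rewrite monE -[_ * u h * _]mulrA u_uV mulr1 -embM tr_emb.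
rewrite mul0r linear0 uVE mulrA [mon _ _ * _]monM !mul_mon_emb tr_mon.
by rewrite -eq_mulgV1 (negPf ne).
Qed.

(** * Inverses of the u_g, and the inverse tensor Xi of the trace form *)

Lemma inv_uniq (x y z : B) : z * x = 1 -> x * y = 1 -> y = z.
Proof. by move=> zx xy; rewrite -[y]mul1r -zx -mulrA xy mulr1. Qed.

Lemma uV_emb g a : uV g * emb (rho g a) = emb a * uV g.
Proof.
rewrite -[LHS]mulr1 -(u_uV F g) mulrA -[_ * u g]mulrA -u_emb.
by rewrite mulrA uV_u mul1r.
Qed.

Lemma uV_1 : uV 1%g = emb ceV.
Proof.
apply: (@inv_uniq (u 1%g)); last exact: u_uV.
by rewrite u_1 -embM ca_mulVe emb1.
Qed.

Lemma uV_mul g h : uV h * uV g = uV (g * h)%g * emb (cV g h).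
Proof.
apply: (@inv_uniq (u g * u h)).
  rewrite u_mul -mulrA [emb _ * _]mulrA -embM ca_mulVc emb1 mul1r.
  exact: uV_u.
by rewrite mulrA -[u g * _ * _]mulrA u_uV mulr1 u_uV.
Qed.

Definition Xi : seq (B * B) :=
  [seq (uV h * emb p.1, emb p.2 * u h) | h <- enum G, p <- xi].

Lemma Xi_sum (W : vectType K) (f : B -> B -> W) :
  \sum_(p <- Xi) f p.1 p.2
  = \sum_h \sum_(p <- xi) f (uV h * emb p.1) (emb p.2 * u h).
Proof. by rewrite big_allpairs_dep big_enum. Qed.

Section XiBilinear.
Variables (W : vectType K) (f : B -> B -> W).
Hypothesis f_bilin : bilin f.
Let fl t k x y : f (k *: x + y) t = k *: f x t + f y t.
Proof. exact: f_bilin.1. Qed.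
Let fr s k x y : f s (k *: x + y) = k *: f s x + f s y.
Proof. exact: f_bilin.2. Qed.

Let fDl s s' t : f (s + s') t = f s t + f s' t.
Proof. by rewrite -[s]scale1r fl !scale1r. Qed.
Let fDr s t t' : f s (t + t') = f s t + f s t'.
Proof. by rewrite -[t]scale1r fr !scale1r. Qed.

Ltac linf := split=> ? k x y; cbn beta;
  rewrite ?(linearP, crossed_mulZl, crossed_mulZr, fl, fr) //.

(** For b = a u_g the summand of index h g on the left matches the summand of index h on the right:
    u_h b is an element of A times u_{hg}, and [xi_bal] carries that element across. *)
Lemma Xi_bal b :
  \sum_(p <- Xi) f (b * p.1) p.2 = \sum_(p <- Xi) f p.1 (p.2 * b).
Proof.
elim/crossed_ind: b => [b b' Pb Pb'|a g].
  under eq_bigr do rewrite mulrDl fDl.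
  under [RHS]eq_bigr do rewrite mulrDr fDr.
  by rewrite !big_split Pb Pb'.
rewrite (Xi_sum (fun s t => f (mon g a * s) t)).
rewrite (Xi_sum (fun s t => f s (t * mon g a))) /= monE.
rewrite (reindex_inj (mulIg g)); apply: eq_bigr => h _ /=.
have uE : u h * emb a * u g = emb (rho h a * c h g) * u (h * g)%g.
  by rewrite u_emb -mulrA u_mul mulrA embM.
have uE' : emb a * u g * uV (h * g)%g = uV h * emb (rho h a * c h g).
  rewrite -[RHS]mulr1 -(u_uV F (h * g)%g) mulrA -[uV h * _ * _]mulrA -uE.
  by rewrite !mulrA uV_u mul1r.
under [RHS]eq_bigr do rewrite -mulrA [u h * _]mulrA uE mulrA -embM.
rewrite -(xi_bal xi_inv
  (f := fun s t => f (uV h * emb s) (emb t * u (h * g)%g))); last by linf.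
by apply: eq_bigr => p _; rewrite embM !mulrA uE'.
Qed.

(** Swapping the legs exchanges the summands of h and h^-1, up to the symmetry and h-invariance of
    xi. *)
Lemma Xi_sym : \sum_(p <- Xi) f p.1 p.2 = \sum_(p <- Xi) f p.2 p.1.
Proof.
rewrite Xi_sum (Xi_sum (fun s t => f t s)).
rewrite [RHS](reindex_inj invg_inj) /=; apply: eq_bigr => h _.
(* u_{h^-1} is u_h^-1 only up to the unit d of A; d and its inverse d' end up on different legs, and
   [xi_bal'] brings them together. *)
pose d := c h h^-1%g * ce; pose d' := ceV * cV h h^-1%g.
have dd : d' * d = 1.
  by rewrite /d /d' -mulrA [cV _ _ * _]mulrA ca_mulVc mul1r ca_mulVe.
have uE : u h^-1%g = uV h * emb d.
  by rewrite uVE -mulrA -embM dd emb1 mulr1.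
have uVE2 : uV h^-1%g = emb d' * u h.
  apply: (@inv_uniq (u h^-1%g)); last exact: u_uV.
  by rewrite uE -mulrA [u h * _]mulrA u_uV mul1r -embM dd emb1.
rewrite [RHS](xi_sym xi_inv
  (f := fun s t => f (emb t * u h^-1%g) (uV h^-1%g * emb s))); last by linf.
transitivity (\sum_(p <- xi)
    f (uV h * emb (rho h p.1 * d)) (emb d' * emb (rho h p.2) * u h));
  last first.
  apply: eq_bigr => p _.
  by rewrite embM mulrA uV_emb uE uVE2 -!mulrA u_emb.
rewrite (xi_rho xi_inv (f := fun s t => f (uV h * emb (s * d))
  (emb d' * emb t * u h))); last first.
  by split=> ? k x y; rewrite ?(mulrDl, linearP, crossed_mulZl, crossed_mulZr,
    fr, =^~ fdalg_scaleAl, fl).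
rewrite (xi_bal' xi_inv (f := fun s t => f (uV h * emb s)
  (emb d' * emb t * u h))); last by linf.
by apply: eq_bigr => p _; rewrite embM [emb d' * _]mulrA -embM dd emb1 mul1r.
Qed.

End XiBilinear.

Lemma Xi_bal' (W : vectType K) (f : B -> B -> W) (f_bilin : bilin f) b :
  \sum_(p <- Xi) f (p.1 * b) p.2 = \sum_(p <- Xi) f p.1 (b * p.2).
Proof.
have [fl fr] := f_bilin.
rewrite [LHS](@Xi_sym _ (fun s t => f (s * b) t)); last first.
  by split=> [t k x y|s]; [rewrite crossed_mulZl fl | apply: fr].
rewrite [RHS](@Xi_sym _ (fun s t => f s (b * t))); last first.
  by split=> [t|s k x y]; [apply: fl | rewrite crossed_mulZr fr].
by rewrite (Xi_bal (bilin_swap f_bilin)).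
Qed.

Lemma cl_congr (W : vectType K) (f : B -> W) : linear f ->
  (forall a x, f (emb a * x) = f (x * emb a)) ->
  forall x x', cl x = cl x' -> f x = f x'.
Proof.
move=> f_lin f_comm x x' e.
have fE z : linfun f z = f z by rewrite linfunE.
have dE z : descend cl (linfun f) (cl z) = f z.
  by rewrite descend_clE ?fE // => a y; rewrite !fE.
by rewrite -dE e dE.
Qed.

(** * The structure maps on HH_0(A), induced from maps on B *)

Definition HHT (g : G) : 'End(C) :=
  descend cl (linfun (fun x : B => cl (u g * x * uV g))).

(** Conjugation by u_g takes commutators with a to commutators with g(a), so it descends. *)
Lemma HHT_cl g x : HHT g (cl x) = cl (u g * x * uV g).
Proof.
have fE y : linfun (fun x : B => cl (u g * x * uV g)) y
    = cl (u g * y * uV g).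
  by rewrite linfunE // => k s t; lin.
rewrite descend_clE ?fE // => a z; rewrite !fE mulrA u_emb -!mulrA cl_comm.
by rewrite -!mulrA uV_emb.
Qed.

Definition cas (x y : B) : B := \sum_(p <- xi) emb p.1 * x * emb p.2 * y.

Lemma cas_linear_l y : linear (cas^~ y).
Proof. by apply: linear_sum_fun => p k s t; lin. Qed.

Lemma cas_linear_r x : linear (cas x).
Proof. by apply: linear_sum_fun => p k s t; lin. Qed.

Lemma cas_mulr x y z : cas x y * z = cas x (y * z).
Proof. by rewrite mulr_suml; apply: eq_bigr => p _; rewrite mulrA. Qed.

Lemma cl_cas x y :
  cl (cas x y) = cl (\sum_(p <- xi) x * emb p.2 * y * emb p.1).
Proof.
rewrite !linear_sum; apply: eq_bigr => p _.
by rewrite /= -!mulrA cl_comm !mulrA.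
Qed.

Lemma cas_comm_l a x y : cas (emb a * x) y = cas (x * emb a) y.
Proof.
transitivity (\sum_(p <- xi) emb (p.1 * a) * x * emb p.2 * y).
  by apply: eq_bigr => p _; rewrite embM !mulrA.
rewrite (xi_bal' xi_inv (f := fun s t => emb s * x * emb t * y)); last by bilin.
by apply: eq_bigr => p _; rewrite embM !mulrA.
Qed.

(** Unlike [cas_comm_l], which holds in B itself, this needs a rotation under [cl] after the shift
    in xi. *)
Lemma cl_cas_comm_r a x y : cl (cas x (emb a * y)) = cl (cas x (y * emb a)).
Proof.
rewrite !linear_sum /=.
transitivity (\sum_(p <- xi) cl (emb p.1 * x * emb (p.2 * a) * y)).
  by apply: eq_bigr => p _; rewrite embM !mulrA.
rewrite -(xi_bal xi_inv (f := fun s t => cl (emb s * x * emb t * y)));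
  last by bilin.
by apply: eq_bigr => p _; rewrite embM -!mulrA cl_comm !mulrA.
Qed.

(** The linear section [cl^-1] picks representatives; [HHmul_cl] shows that the product does not
    depend on them. *)
Definition HHmul : 'Hom(tensv C C, C) :=
  tens_lift (fun p q => cl (cas (cl^-1%VF p) (cl^-1%VF q))).

Lemma HHmul_cl x y : HHmul (tens (cl x) (cl y)) = cl (cas x y).
Proof.
rewrite tens_liftE => [|q k s t|p k s t]; last 2 first.
- by rewrite linearP cas_linear_l linearP.
- by rewrite linearP cas_linear_r linearP.
transitivity (cl (cas x (cl^-1%VF (cl y)))).
  apply: (@cl_congr _ (fun x => cl (cas x _))) => [k s t|a s|].
  - by rewrite cas_linear_l linearP.
  - by rewrite cas_comm_l.
  - by rewrite cl_secK.
apply: (@cl_congr _ (fun y => cl (cas x y))) => [k s t|a s|].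
- by rewrite cas_linear_r linearP.
- exact: cl_cas_comm_r.
- by rewrite cl_secK.
Qed.

Definition HHcomul : 'Hom(C, tensv C C) := descend cl
  (linfun (fun x : B => \sum_(p <- Xi) tens (cl (x * p.1)) (cl p.2))).

(** The map descends because a z Xi' (x) Xi'' rotates to z Xi' a (x) Xi'' = z Xi' (x) a Xi'', which
    rotates to z Xi' (x) Xi'' a = z a Xi' (x) Xi''. *)
Lemma HHcomul_cl x :
  HHcomul (cl x) = \sum_(p <- Xi) tens (cl (x * p.1)) (cl p.2).
Proof.
set f := fun x : B => \sum_(p <- Xi) tens (cl (x * p.1)) (cl p.2).
have fE y : linfun f y = f y.
  by rewrite linfunE //; apply: linear_sum_fun => p k s t; lin.
rewrite descend_clE ?fE // => a z; rewrite !fE /f.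
transitivity (\sum_(p <- Xi) tens (cl (z * (p.1 * emb a))) (cl p.2)).
  by apply: eq_bigr => p _; rewrite -mulrA cl_comm mulrA.
rewrite (Xi_bal' (f := fun s t => tens (cl (z * s)) (cl t))); last by bilin.
transitivity (\sum_(p <- Xi) tens (cl (z * (emb a * p.1))) (cl p.2));
  last first.
  by apply: eq_bigr => p _; rewrite mulrA.
rewrite (Xi_bal (f := fun s t => tens (cl (z * s)) (cl t))); last by bilin.
by apply: eq_bigr => p _; rewrite cl_comm.
Qed.

Definition HHtheta : 'Hom(HH0 F 1%g, K^o) :=
  (descend cl tr \o dinj (HH0 F) 1%g)%VF.

Lemma HHtheta_pi a : HHtheta (quotv_pi (HH0_rel F 1%g) a) = tr (mon 1%g a).
Proof.
rewrite comp_lfunE -[dinj _ _ _]/(HH0_cls F 1%g a) -cl_mon.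
by rewrite descend_clE // => b x; apply: tr_embC.
Qed.

Lemma HHtheta_cl x : HHtheta (dproj (HH0 F) 1%g (cl x)) = tr x.
Proof.
rewrite dproj_cl HHtheta_pi tr_mon eqxx linfunE //; exact: tr_linear.
Qed.

Lemma mon_uV a g h : mon (g * h)%g a * uV h = mon g (a * cV g h).
Proof.
have -> : mon (g * h)%g a = mon g (a * cV g h) * u h.
  by rewrite monM ca_rho1 mulr1 -mulrA ca_mulVc mulr1.
by rewrite -mulrA u_uV mulr1.
Qed.

Lemma cas_mon g h a b :
  cas (mon g a) (mon h b) = mon (g * h)%g (HH0_m F xi g h a b).
Proof.
rewrite linear_sum; apply: eq_bigr => p _ /=.
by rewrite mul_emb_mon -mulrA mul_emb_mon monM.
Qed.

(** Since u_g^-1 = u_{g^-1} c_e^-1 c_{g,g^-1}^-1, rotating the last two factors to the front yields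
    exactly the formula for T_h(g). *)
Lemma cl_conj_mon g h a : cl (u g * mon h a * uV g)
  = cl (mon (g * h * g^-1)%g (HH0_T F h g a)).
Proof.
rewrite uVE mulrA -cl_comm /cr_u [mon g 1 * _]monM monM mul_emb_mon ca_rho1.
by rewrite mul1r mulr1 /HH0_T !mulrA.
Qed.

Lemma HH_induced : HH0_induced xi HHT HHmul HHcomul HHtheta.
Proof.
split=> [g h a|g h a b|k a|a].
- by rewrite -!cl_mon HHT_cl cl_conj_mon.
- by rewrite -!cl_mon HHmul_cl cas_mon.
- rewrite -cl_mon HHcomul_cl.
  rewrite (Xi_sum (fun s t => tens (cl (mon k a * s)) (cl t))).
  (* The sum over h in Xi runs over the factorizations k = (k h^-1) h. *)
  rewrite (reindex (fun h => ((k * h^-1)%g, h))) /=; last first.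
    exists snd => [h _ //|[g h]]; rewrite unfold_in /= => /eqP <-.
    by rewrite mulgK.
  apply: eq_big => [h|h _]; first by rewrite mulgKV eqxx.
  apply: eq_bigr => p _; rewrite mulrA -{1}(mulgKV h k) mon_uV mul_mon_emb.
  by rewrite -[emb p.2 * _]monE !cl_mon.
- by rewrite HHtheta_pi tr_mon eqxx.
Qed.

(** * The axioms of a weak crossed G-algebra *)

Local Notation T := HHT.
Local Notation m := HHmul.
Local Notation D := HHcomul.
Local Notation th := HHtheta.

Lemma dcompP h y : reflect (exists a, y = cl (mon h a)) (y \in dcomp (HH0 F) h).
Proof.
apply: (iffP memv_imgP) => [[v _ ->]|[a ->]].
  by have [a ->] := quotv_pi_surj v; exists a; rewrite cl_mon.
by exists (quotv_pi (HH0_rel F h) a); rewrite ?memvf // cl_mon.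
Qed.

Lemma HHT_1 : T 1%g = \1%VF.
Proof.
apply/lfunP => y; have [x ->] := cl_surj y; rewrite HHT_cl id_lfunE.
by rewrite u_1 -mulrA cl_comm -mulrA -u_1 uV_u mulr1.
Qed.

(** u_g u_h and u_{gh} differ by the unit c_{g,h} of A, and conjugation by a unit of A is trivial on
    classes. *)
Lemma HHT_mul g h : T (g * h)%g = (T g \o T h)%VF.
Proof.
apply/lfunP => y; have [x ->] := cl_surj y.
rewrite comp_lfunE !HHT_cl !mulrA u_mul -!mulrA uV_mul cl_comm -!mulrA -embM.
by rewrite ca_mulVc emb1 mulr1.
Qed.

Lemma HHTK g y : T g (T g^-1%g y) = y.
Proof. by rewrite -comp_lfunE -HHT_mul mulgV HHT_1 id_lfunE. Qed.

Lemma HHT_inv_cl h x : T h^-1%g (cl x) = cl (uV h * x * u h).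
Proof.
have {1}-> : cl x = T h (cl (uV h * x * u h)).
  by rewrite HHT_cl -!mulrA u_uV mulr1 mulrA u_uV mul1r.
by have := HHTK h^-1%g; rewrite invgK.
Qed.

Lemma HHT_dcomp g h y : y \in dcomp (HH0 F) h ->
  T g y \in dcomp (HH0 F) (g * h * g^-1)%g.
Proof.
move=> /dcompP[a ->]; rewrite HHT_cl cl_conj_mon.
by apply/dcompP; exists (HH0_T F h g a).
Qed.

Lemma dcompK h y : y \in dcomp (HH0 F) h ->
  dinj (HH0 F) h (dproj (HH0 F) h y) = y.
Proof. by move=> /memv_imgP[v _ ->]; rewrite dinjK. Qed.

Lemma actcE g h k y : y \in dcomp (HH0 F) h ->
  wc_actc T g h k (dproj (HH0 F) h y) = dproj (HH0 F) k (T g y).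
Proof. by move=> yh; rewrite !comp_lfunE dcompK. Qed.

Lemma wc_lmulE x y : wc_lmul m x y = m (tens x y).
Proof. by rewrite /wc_lmul linfunE // => k s t; rewrite tensPr linearP. Qed.

Lemma wc_rmulE x y : wc_rmul m x y = m (tens y x).
Proof. by rewrite /wc_rmul linfunE // => k s t; rewrite tensPl linearP. Qed.

Lemma lmulcE x h k y : y \in dcomp (HH0 F) h ->
  wc_lmulc m x h k (dproj (HH0 F) h y) = dproj (HH0 F) k (m (tens x y)).
Proof. by move=> yh; rewrite !comp_lfunE dcompK // wc_lmulE. Qed.

(** The second leg of the summand of index k in Xi has degree k, so only k = h survives the
    projection. *)
Lemma comulcE g h x : wc_comulc D g h (cl x) = \sum_(p <- xi)
  tens (dproj (HH0 F) g (cl (x * uV h * emb p.1)))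
       (dproj (HH0 F) h (cl (emb p.2 * u h))).
Proof.
rewrite comp_lfunE HHcomul_cl linear_sum /=.
under eq_bigr do rewrite tens_mapE.
rewrite (Xi_sum (fun s t => tens (dproj (HH0 F) g (cl (x * s)))
  (dproj (HH0 F) h (cl t)))).
rewrite (bigD1 h) //= [X in _ + X]big1 ?addr0.
  by apply: eq_bigr => p _; rewrite mulrA.
move=> k ne; apply: big1 => p _.
rewrite -[emb p.2 * _]monE [X in tens _ X]dproj_cl coef_mon (negPf ne).
(* Writing 0 as (-1) 0 + 0 lets linearity in the second leg show that [tens] vanishes there. *)
rewrite linear0 -(subrr (0 : HH0 F h)) -[- 0]scaleN1r addrC tensPr.
by rewrite scaleN1r addNr.
Qed.

Lemma HHT_comp g h :
  (T g @: dcomp (HH0 F) h)%VS = dcomp (HH0 F) (g * h * g^-1)%g.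
Proof.
apply/eqP; rewrite eqEsubv; apply/andP; split; apply/subvP => y.
  by move=> /memv_imgP[z zh ->]; apply: HHT_dcomp.
move=> /(HHT_dcomp g^-1%g); rewrite !mulgA mulVg mul1g mulgK => yh.
by rewrite -(HHTK g y); apply: memv_img.
Qed.

Lemma HHT_id g : {in dcomp (HH0 F) g, forall x, T g x = x}.
Proof.
move=> _ /dcompP[a ->]; rewrite HHT_cl monE -!mulrA u_uV mulr1.
by rewrite -cl_comm.
Qed.

Lemma HHtheta_inv g x : th (wc_actc T g 1%g 1%g x) = th x.
Proof.
have [a ->] := quotv_pi_surj x.
have -> : quotv_pi (HH0_rel F 1%g) a = dproj (HH0 F) 1%g (cl (mon 1%g a)).
  by rewrite dproj_cl coef_mon eqxx.
rewrite actcE; last by apply/dcompP; exists a.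
by rewrite HHT_cl !HHtheta_cl tr_conj.
Qed.

(** With q for the outer copy of xi and p for the inner one, [xi_bal] moves q' from the left of p'
    to the right of p''. *)
Lemma cas_assoc x y z : cas (cas x y) z = cas x (cas y z).
Proof.
transitivity (\sum_(q <- xi) \sum_(p <- xi)
  emb q.1 * emb p.1 * x * emb p.2 * y * emb q.2 * z).
  apply: eq_bigr => q _; rewrite mulr_sumr !mulr_suml.
  by apply: eq_bigr => p _; rewrite !mulrA.
transitivity (\sum_(p <- xi) \sum_(q <- xi)
  emb p.1 * x * emb (p.2 * q.1) * y * emb q.2 * z); last first.
  apply: eq_bigr => p _; rewrite mulr_sumr.
  by apply: eq_bigr => q _; rewrite embM !mulrA.
rewrite [RHS]exchange_big; apply: eq_bigr => q _ /=.
rewrite -[RHS](xi_bal xi_inv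
  (f := fun s t => emb s * x * emb t * y * emb q.2 * z));
  last by bilin.
by apply: eq_bigr => p _; rewrite embM.
Qed.

Lemma HHmul_assoc x y z : m (tens (m (tens x y)) z) = m (tens x (m (tens y z))).
Proof.
have [[a ->] [b ->] [d ->]] := And3 (cl_surj x) (cl_surj y) (cl_surj z).
by rewrite !HHmul_cl cas_assoc.
Qed.

Lemma HHcomul_assoc : (tens_assoc C C C \o tens_map D \1 \o D)%VF
  = (tens_map \1 D \o D)%VF.
Proof.
apply/lfunP => y; have [x ->] := cl_surj y.
rewrite !comp_lfunE HHcomul_cl !linear_sum /=.
transitivity (\sum_(q <- Xi) \sum_(p <- Xi)
  tens (cl (x * q.1 * p.1)) (tens (cl p.2) (cl q.2))).
  apply: eq_bigr => q _.
  rewrite tens_mapE HHcomul_cl id_lfunE tens_suml linear_sum.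
  by apply: eq_bigr => p _; rewrite /= tens_assocE.
transitivity (\sum_(p <- Xi) \sum_(q <- Xi)
  tens (cl (x * p.1)) (tens (cl (p.2 * q.1)) (cl q.2))); last first.
  apply: eq_bigr => p _; rewrite tens_mapE HHcomul_cl id_lfunE tens_sumr.
  by apply: eq_bigr.
rewrite [RHS]exchange_big; apply: eq_bigr => q _ /=.
rewrite -(Xi_bal
  (f := fun s t => tens (cl (x * s)) (tens (cl t) (cl q.2)))); last by bilin.
by apply: eq_bigr => p _; rewrite mulrA.
Qed.

Lemma cas_conj g x y :
  u g * cas x y * uV g = cas (u g * x * uV g) (u g * y * uV g).
Proof.
rewrite /cas -[in RHS](xi_rho xi_inv
  (f := fun s t => emb s * (u g * x * uV g) * emb t * (u g * y * uV g)) _ g);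
  last by bilin.
rewrite mulr_sumr mulr_suml; apply: eq_bigr => p _.
rewrite !mulrA -u_emb -[_ * uV g * emb (rho _ _)]mulrA uV_emb !mulrA.
by rewrite -[_ * uV g * u g]mulrA uV_u mulr1.
Qed.

Lemma HHT_mulM g x y : T g (m (tens x y)) = m (tens (T g x) (T g y)).
Proof.
have [[a ->] [b ->]] := conj (cl_surj x) (cl_surj y).
by rewrite HHmul_cl !HHT_cl HHmul_cl cas_conj.
Qed.

Lemma HHmul_comp g h : {in dcomp (HH0 F) g & dcomp (HH0 F) h, forall x y,
  m (tens x y) \in dcomp (HH0 F) (g * h)%g}.
Proof.
move=> _ _ /dcompP[a ->] /dcompP[b ->]; rewrite HHmul_cl cas_mon.
by apply/dcompP; exists (HH0_m F xi g h a b).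
Qed.

(** For x = a u_g and y the class of b, the right side is \sum xi' w xi'' a u_g with w = u_g b
    u_g^-1. Shift a to the front, replace xi by its image under g and pull u_g to the left; this
    gives \sum a u_g xi' b xi'', which is the left side by symmetry of xi and a rotation. *)
Lemma HHmul_comm g x y : x \in dcomp (HH0 F) g ->
  m (tens x y) = m (tens (T g y) x).
Proof.
move=> /dcompP[a ->]; have [b ->] := cl_surj y.
rewrite HHT_cl !HHmul_cl cl_cas monE.
set w := u g * b * uV g.
transitivity (\sum_(p <- xi) cl (emb p.1 * w * emb (p.2 * a) * u g));
  last first.
  by rewrite linear_sum; apply: eq_bigr => p _; rewrite /= embM !mulrA.
rewrite -(xi_bal xi_inv (f := fun s t => cl (emb s * w * emb t * u g)));
  last by bilin.
transitivity (\sum_(p <- xi)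
    cl (emb a * emb p.1 * w * emb p.2 * u g)); last first.
  by apply: eq_bigr => p _; rewrite embM.
rewrite -[RHS](xi_rho xi_inv
  (f := fun s t => cl (emb a * emb s * w * emb t * u g)) _ g); last by bilin.
transitivity (\sum_(p <- xi)
    cl (emb a * u g * emb p.1 * b * emb p.2)); last first.
  apply: eq_bigr => p _; rewrite /w -[_ * emb (rho g p.2) * u g]mulrA -u_emb.
  rewrite !mulrA -[_ * uV g * u g]mulrA uV_u mulr1.
  by rewrite -[_ * emb (rho g p.1) * u g]mulrA -u_emb !mulrA.
rewrite linear_sum; apply: (xi_sym xi_inv (f := fun s t =>
  cl (emb a * u g * emb t * b * emb s))).
by bilin.
Qed.

(** Xi commutes with u_g^-1: [Xi_bal] moves it from the right end of the second leg to the left of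
    Xi', and [Xi_bal'] moves the remaining one from the first leg to cancel u_g in the second. *)
Lemma HHT_comul g : (tens_map (T g) (T g) \o D)%VF = (D \o T g)%VF.
Proof.
apply/lfunP => y; have [x ->] := cl_surj y.
rewrite !comp_lfunE HHT_cl !HHcomul_cl linear_sum /=.
transitivity (\sum_(p <- Xi)
    tens (cl (u g * x * p.1 * uV g)) (cl (u g * (p.2 * uV g)))).
  by apply: eq_bigr => p _; rewrite tens_mapE !HHT_cl !mulrA.
rewrite -(Xi_bal
  (f := fun s t => tens (cl (u g * x * s * uV g)) (cl (u g * t))));
  last by bilin.
transitivity (\sum_(p <- Xi)
    tens (cl (u g * x * uV g * (p.1 * uV g))) (cl (u g * p.2))).
  by apply: eq_bigr => p _; rewrite !mulrA.
rewrite (Xi_bal'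
  (f := fun s t => tens (cl (u g * x * uV g * s)) (cl (u g * t))));
  last by bilin.
by apply: eq_bigr => p _; rewrite mulrA u_uV mul1r.
Qed.

Lemma HHcomul_comp k : {in dcomp (HH0 F) k, forall x, D x \in
  (\sum_(gh : G * G | (gh.1 * gh.2)%g == k)
    limg (tens_map (dinj (HH0 F) gh.1) (dinj (HH0 F) gh.2)))%VS}.
Proof.
move=> _ /dcompP[a ->]; rewrite cl_mon (HH0_inducedD HH_induced).
apply: memv_sumr => -[g h] _; rewrite memv_suml // => p _.
by rewrite -tens_mapE memv_img ?memvf.
Qed.

Lemma HHcomul_comm g h : {in dcomp (HH0 F) (g * h)%g, forall x,
  wc_comulc D g h x = tens_swap (HH0 F h) (HH0 F g)
    (tens_map \1 (wc_actc T h (h^-1 * g * h)%g g)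
      (wc_comulc D h (h^-1 * g * h)%g x))}.
Proof.
move=> _ /dcompP[a ->]; set k := (h^-1 * g * h)%g.
have hk : (h * k = g * h)%g by rewrite /k !mulgA mulgV mul1g.
(* With k = h^-1 g h, the representative is a u_{gh} = b u_h u_k = b e u_g u_h. The left side uses
   the last form to cancel u_h^-1, the right side the middle one to cancel u_k^-1. *)
pose b := a * cV h k; pose e := c h k * cV g h.
have xE : mon (g * h)%g a = emb b * u h * u k.
  rewrite -mulrA u_mul mulrA -embM /b -mulrA ca_mulVc mulr1 hk.
  exact: monE.
have huk : u h * u k = emb e * u g * u h.
  by rewrite -mulrA u_mul u_mul mulrA -embM hk /e -mulrA ca_mulVc mulr1.
clearbody b e; rewrite !comulcE !linear_sum /=.
pose f s t := tens (dproj (HH0 F) g (cl (emb s * u g)))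
                   (dproj (HH0 F) h (cl (emb (b * e * t) * u h))).
have f_bilin : bilin f.
  split=> ? ? ? ?; rewrite /f ?(linearP, crossed_mulZl, tensPl) //.
  by rewrite mulrDr -fdalg_scaleAr ?(linearP, crossed_mulZl, tensPr).
transitivity (\sum_(p <- xi) f p.1 p.2).
  transitivity (\sum_(p <- xi) tens
    (dproj (HH0 F) g (cl (u g * emb (p.1 * (b * e)))))
    (dproj (HH0 F) h (cl (emb p.2 * u h)))).
    apply: eq_bigr => p _; congr (tens (dproj _ _ _) _).
    rewrite xE -[emb b * _ * _]mulrA huk !mulrA -embM -[_ * u h * uV h]mulrA.
    by rewrite u_uV mulr1 -mulrA cl_comm -mulrA -embM mulrA.
  rewrite (xi_bal' xi_inv (f := fun s t => tens
    (dproj (HH0 F) g (cl (u g * emb s))) (dproj (HH0 F) h (cl (emb t * u h)))));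
    last by bilin.
  by apply: eq_bigr => p _; rewrite -cl_comm.
transitivity (\sum_(p <- xi) f p.2 p.1); first exact: (xi_sym xi_inv f_bilin).
pose f' s t := tens (dproj (HH0 F) g (cl (emb t * u g)))
                   (dproj (HH0 F) h (cl (emb b * emb s * u h))).
have f'_bilin : bilin f' by rewrite /f'; bilin.
transitivity (\sum_(p <- xi) f' (e * p.1) p.2).
  by apply: eq_bigr => p _; rewrite /f /f' !embM !mulrA.
rewrite (xi_bal xi_inv f'_bilin).
pose f2 s t := f' s (t * e).
have f2_bilin : bilin f2.
  split=> ? ? ? ?; first by rewrite /f2 f'_bilin.1.
  by rewrite /f2 mulrDl -fdalg_scaleAl f'_bilin.2.
rewrite -(xi_rho xi_inv f2_bilin h); apply: eq_bigr => p _.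
rewrite tens_mapE tens_swapE id_lfunE actcE; last first.
  by apply/dcompP; exists p.2; rewrite monE.
rewrite HHT_cl xE /f2 /f'; congr (tens (dproj _ _ _) (dproj _ _ (cl _))).
  rewrite mulrA u_emb -[_ * u h * u k]mulrA huk !mulrA -embM.
  by rewrite -[_ * u h * uV h]mulrA u_uV mulr1.
by rewrite -[_ * u k * uV k]mulrA u_uV mulr1 -!mulrA u_emb.
Qed.

Lemma HHcounit_l g (x : HH0 F g) :
  tens_lift (fun (a : HH0 F 1%g) (b : HH0 F g) => (th a : K) *: b)
    (wc_comulc D 1%g g (dinj (HH0 F) g x)) = x.
Proof.
have [a ->] := quotv_pi_surj x.
rewrite -[dinj _ _ _]/(HH0_cls F g a) -cl_mon comulcE linear_sum /=.
rewrite -[in RHS](xi_dual xi_inv a) linear_sum; apply: eq_bigr => p _ /=.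
rewrite tens_liftE => [|w k s t|w k s t]; last 2 first.
- by rewrite linearP scalerDl scalerA.
- by rewrite scalerDr !scalerA mulrC.
rewrite HHtheta_cl monE -[_ * u g * _]mulrA u_uV mulr1 -embM tr_emb.
by rewrite -monE dproj_cl coef_mon eqxx linearZ.
Qed.

Lemma HHcounit_r g (x : HH0 F g) :
  tens_lift (fun (a : HH0 F g) (b : HH0 F 1%g) => (th b : K) *: a)
    (wc_comulc D g 1%g (dinj (HH0 F) g x)) = x.
Proof.
have [a ->] := quotv_pi_surj x.
rewrite -[dinj _ _ _]/(HH0_cls F g a) -cl_mon comulcE linear_sum /=.
(* The first leg of the coproduct contributes u_e^-1 = c_e^-1; the counit turns xi into \sum
   theta(c_e xi'') xi' = c_e, which cancels it. *)
have aE : a = coef g (mon g a * emb ceV * emb ce).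
  by rewrite -mulrA -embM ca_mulVe emb1 mulr1 coef_mon eqxx.
have ceE : emb ce = \sum_(p <- xi) (theta (ce * p.2) : K) *: emb p.1.
  rewrite {1}(xi_inv.2 ce) linear_sum.
  by apply: eq_bigr => p _; rewrite linearZ.
rewrite [in RHS]aE ceE mulr_sumr !linear_sum.
apply: eq_bigr => p _ /=.
rewrite tens_liftE => [|w k s t|w k s t]; last 2 first.
- by rewrite scalerDr !scalerA mulrC.
- by rewrite linearP scalerDl scalerA.
rewrite HHtheta_cl u_1 -embM tr_emb uV_1 tf_thetaC.
by rewrite -crossed_scaleAr !linearZ /= dproj_cl.
Qed.

Lemma HHcomul_lmul x y :
  D (m (tens x y)) = tens_map (wc_lmul m x) \1 (D y).
Proof.
have [[a ->] [b ->]] := conj (cl_surj x) (cl_surj y).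
rewrite HHmul_cl !HHcomul_cl linear_sum; apply: eq_bigr => p _ /=.
by rewrite tens_mapE id_lfunE wc_lmulE HHmul_cl cas_mulr.
Qed.

(** With q the copy of xi in the product, [Xi_bal] sends q'' y to the right of Xi''; q' is rotated
    behind Xi' and sent by [Xi_bal'] to the left of Xi''. The second leg is then the product of Xi''
    and y. *)
Lemma HHcomul_rmul x y :
  D (m (tens x y)) = tens_map \1 (wc_rmul m y) (D x).
Proof.
have [[a ->] [b ->]] := conj (cl_surj x) (cl_surj y).
rewrite HHmul_cl !HHcomul_cl linear_sum /=.
transitivity (\sum_(q <- xi) \sum_(p <- Xi)
  tens (cl (emb q.1 * a * (emb q.2 * b * p.1))) (cl p.2)).
  rewrite exchange_big; apply: eq_bigr => p _ /=.
  rewrite -tens_suml -linear_sum mulr_suml.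
  by congr (tens (cl _) _); apply: eq_bigr => q _; rewrite !mulrA.
transitivity (\sum_(q <- xi) \sum_(p <- Xi)
  tens (cl (a * p.1)) (cl (emb q.1 * p.2 * emb q.2 * b))); last first.
  rewrite exchange_big; apply: eq_bigr => p _ /=.
  rewrite tens_mapE id_lfunE wc_rmulE HHmul_cl.
  rewrite [cl (cas p.2 b)](linear_sum cl) tens_sumr.
  by apply: eq_bigr.
apply: eq_bigr => q _.
rewrite (Xi_bal (f := fun s t => tens (cl (emb q.1 * a * s)) (cl t)));
  last by bilin.
transitivity (\sum_(p <- Xi)
    tens (cl (a * (p.1 * emb q.1))) (cl (p.2 * (emb q.2 * b)))).
  apply: eq_bigr => p _.
  by rewrite -[emb q.1 * a * _]mulrA cl_comm -[a * _ * _]mulrA.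
rewrite (Xi_bal'
  (f := fun s t => tens (cl (a * s)) (cl (t * (emb q.2 * b)))));
  last by bilin.
by apply: eq_bigr => p _; rewrite !mulrA.
Qed.

(** As it kills [A, B], this map makes multiplication by a fixed class a map from HH_0(A) back to B
    ([cl_cas_sandwich]), as needed to compute traces on A. *)
Definition sandwich : 'Hom(B, B) :=
  linfun (fun y : B => \sum_(p <- xi) emb p.2 * y * emb p.1).

Lemma sandwichE y : sandwich y = \sum_(p <- xi) emb p.2 * y * emb p.1.
Proof.
by rewrite /sandwich linfunE //; apply: linear_sum_fun => p k s t; lin.
Qed.

Lemma sandwich_comm a y : sandwich (emb a * y) = sandwich (y * emb a).
Proof.
rewrite !sandwichE.
transitivity (\sum_(p <- xi) emb (p.2 * a) * y * emb p.1).
  by apply: eq_bigr => p _; rewrite embM !mulrA.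
rewrite -(xi_bal xi_inv (f := fun s t => emb t * y * emb s)); last by bilin.
by apply: eq_bigr => p _; rewrite embM !mulrA.
Qed.

Lemma cl_cas_sandwich x y : cl (cas x y) = cl (x * sandwich y).
Proof.
rewrite cl_cas sandwichE mulr_sumr; congr (cl _).
by apply: eq_bigr => p _; rewrite !mulrA.
Qed.

(* With p the projection A -> HH_0(A)_h, the hypothesis on N writes op as     *)
(* p \o n where n \o p is the endomorphism of A induced by N.                 *)
Lemma lftrace_HH0 h (op : 'End(HH0 F h)) (N : 'Hom(B, B)) :
    (forall a x, N (emb a * x) = N (x * emb a)) ->
    (forall a, op (quotv_pi (HH0_rel F h) a)
      = quotv_pi (HH0_rel F h) (coef h (N (mon h a)))) ->
  lftrace op = \sum_(p <- xi) (tr (N (mon h p.1) * uV h * emb p.2) : K).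
Proof.
move=> N_comm opE; pose p := quotv_pi (HH0_rel F h).
pose n : 'Hom(HH0 F h, A) :=
  linfun (fun q => coef h (descend cl N (dinj (HH0 F) h q))).
have nE a : n (p a) = coef h (N (mon h a)).
  rewrite linfunE => [|k s t]; last by rewrite !linearP.
  by rewrite -[dinj _ _ _]/(HH0_cls F h a) -cl_mon descend_clE.
have -> : op = (p \o n)%VF.
  apply/lfunP => q; have [a ->] := quotv_pi_surj q.
  by rewrite comp_lfunE opE -[quotv_pi _ a]/(p a) nE.
rewrite lftraceC (lftrace_xi xi_inv); apply: eq_bigr => q _.
by rewrite comp_lfunE nE theta_coef.
Qed.

(** The operators come from N1(x) = z S(u_g x u_g^-1) and N2(y) = u_h^-1 z S(y) u_h on B, where S is
    [sandwich]. After [lftrace_HH0], cyclicity of [tr] and h-invariance of xi bring the first trace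
    to a form which, with S expanded, differs from the second only by shifts in the two copies of
    xi. *)
Lemma HHtorus g h : {in dcomp (HH0 F) (h * g * h^-1 * g^-1)%g, forall x,
  lftrace (wc_lmulc m x (g * h * g^-1)%g h \o wc_actc T g h (g * h * g^-1)%g)
  = lftrace (wc_actc T h^-1%g (h * g * h^-1)%g g
             \o wc_lmulc m x g (h * g * h^-1)%g)}.
Proof.
move=> _ /dcompP[b ->]; set z := mon _ b.
have pi_cl k a : quotv_pi (HH0_rel F k) a = dproj (HH0 F) k (cl (mon k a)).
  by rewrite dproj_cl coef_mon eqxx.
have cl_in k a : cl (mon k a) \in dcomp (HH0 F) k by apply/dcompP; exists a.
pose N1 : 'Hom(B, B) := linfun (fun x => z * sandwich (u g * x * uV g)).
have N1E x : N1 x = z * sandwich (u g * x * uV g).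
  by rewrite /N1 linfunE // => k s t; lin.
pose N2 : 'Hom(B, B) := linfun (fun y => uV h * (z * sandwich y) * u h).
have N2E y : N2 y = uV h * (z * sandwich y) * u h.
  by rewrite /N2 linfunE // => k s t; lin.
rewrite (@lftrace_HH0 h _ N1) => [|a x|a]; last 2 first.
- by rewrite !N1E mulrA u_emb -!mulrA sandwich_comm -!mulrA uV_emb.
- rewrite pi_cl comp_lfunE actcE // lmulcE; last exact: HHT_dcomp.
  by rewrite HHT_cl HHmul_cl // cl_cas_sandwich -N1E dproj_cl.
rewrite (@lftrace_HH0 g _ N2) => [|a y|a]; last 2 first.
- by rewrite !N2E sandwich_comm.
- rewrite pi_cl comp_lfunE lmulcE // actcE; last first.
    have := HHmul_comp (cl_in (h * g * h^-1 * g^-1)%g b)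
      (cl_in g a).
    by rewrite mulgKV.
  by rewrite HHmul_cl // cl_cas_sandwich HHT_inv_cl -N2E dproj_cl.
(* Both traces become the sum over xi of tr (u_h^-1 z Q(xi') xi''). *)
pose Q (a : A) := sandwich (u g * emb a * u h * uV g).
(* h(a) passes u_h to become a, passes u_g^-1 to become g(a), is rotated to the front inside
   [sandwich], and passes u_g to become a again. *)
have Q_rho a : Q (rho h a) = Q a.
  rewrite /Q -[u g * _ * u h]mulrA -u_emb -!mulrA -[emb a * uV g]uV_emb.
  rewrite !mulrA -sandwich_comm !mulrA.
  by rewrite -u_emb.
have Q_lin k s t : Q (k *: s + t) = k *: Q s + Q t by rewrite /Q; lin.
pose f s t := tr (uV h * emb t * z * Q s).
have f_bilin : bilin f.
  by split=> ? ? ? ?; rewrite /f ?Q_lin; lin.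
transitivity (\sum_(p <- xi) f p.1 p.2).
  apply: eq_bigr => p _; rewrite N1E monE !mulrA -/(Q p.1).
  by rewrite -mulrA trC !mulrA.
rewrite -(xi_rho xi_inv f_bilin h).
transitivity (\sum_(p <- xi) (tr (uV h * z * Q p.1 * emb p.2) : K)).
  apply: eq_bigr => p _; rewrite /f Q_rho uV_emb [RHS]trC.
  by rewrite !mulrA.
pose w := uV h * z.
transitivity (\sum_(q <- xi) \sum_(p <- xi)
  (tr (w * emb q.2 * u g * emb p.1 * u h * uV g * emb (q.1 * p.2)) : K)).
  rewrite exchange_big; apply: eq_bigr => p _ /=.
  rewrite /Q sandwichE mulr_sumr mulr_suml linear_sum; apply: eq_bigr => q _.
  by rewrite /= embM !mulrA.
transitivity (\sum_(p <- xi) \sum_(q <- xi)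
  (tr (w * emb (q.2 * p.1) * u g * emb q.1 * u h * uV g * emb p.2) : K));
  last first.
  apply: eq_bigr => p _.
  rewrite N2E monE sandwichE mulr_sumr mulr_sumr !mulr_suml linear_sum.
  by apply: eq_bigr => q _; rewrite /= embM !mulrA.
(* The middle form carries p' q' between u_g and u_h: the first double sum reaches it by a shift in
   p, the second by a shift in q. *)
transitivity (\sum_(q <- xi) \sum_(p <- xi)
  (tr (w * emb q.2 * u g * emb (p.1 * q.1) * u h * uV g * emb p.2) : K)).
  apply: eq_bigr => q _; symmetry; apply: (xi_bal' xi_inv (f := fun s t =>
    tr (w * emb q.2 * u g * emb s * u h * uV g * emb t))).
  by bilin.
rewrite exchange_big; apply: eq_bigr => p _ /=.
apply: (xi_bal xi_inv (f := fun s t =>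
  tr (w * emb t * u g * emb s * u h * uV g * emb p.2))).
by bilin.
Qed.

End HochschildBundle.

Theorem theorem5p3 (G : finGroupType) (K : fieldType) (A : fdAlgebra K)
    (F : twistedFrobenius G A) (xi : seq (A * A))
    (xi_inv : inverse_tensor (tf_theta F) xi) :
  exists (T : G -> 'End(dsum (HH0 F)))
    (m : 'Hom(tensv (dsum (HH0 F)) (dsum (HH0 F)), dsum (HH0 F)))
    (D : 'Hom(dsum (HH0 F), tensv (dsum (HH0 F)) (dsum (HH0 F))))
    (theta : 'Hom(HH0 F 1%g, K^o)),
    HH0_induced xi T m D theta /\ weak_crossed T m D theta.
Proof.
exists (HHT F), (HHmul F xi), (HHcomul F xi), (HHtheta F).
split; first exact: HH_induced.
split.
- exact: HHT_1.
- exact: HHT_mul.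
- exact: HHT_comp.
- exact: HHT_id.
- exact: HHtheta_inv.
- exact: HHmul_assoc.
- exact: HHcomul_assoc.
- exact: HHT_mulM.
- exact: HHmul_comp.
- by move=> g h x y xg _; apply: HHmul_comm.
- exact: HHtorus.
- exact: HHT_comul.
- exact: HHcomul_comp.
- exact: HHcomul_comm.
- exact: HHcounit_l.
- exact: HHcounit_r.
- exact: HHcomul_lmul.
- exact: HHcomul_rmul.
Qed.
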